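(* Let $\sigma,\mu$ be positive measures on $\mathbb R$ with $\int_{\mathbb R}\frac{d\sigma(u)}{u^2+1}<\infty$ and $\int_{\mathbb R}\frac{d\mu(u)}{u^2+1}<\infty$, such that the associated real Hilbert spaces $\mathcal H(\sigma)$ and $\mathcal H(\mu)$ are separable and infinite-dimensional. Let $(g_n)_{n\ge 0}$ and $(h_n)_{n\ge 0}$ be orthonormal bases of $\mathcal H(\sigma)$ and $\mathcal H(\mu)$ respectively. Put $P_1=P_\sigma$, $P_2=P_\mu$, $Z_n=Q^{\sigma}_{g_n}\in L^2(\mathcal S'_{\mathbb R},\mathcal C,P_1)$ and $W_n=Q^{\mu}_{h_n}\in L^2(\mathcal S'_{\mathbb R},\mathcal C,P_2)$. For $p=\lambda_1e_++\lambda_2e_-\in\mathbb H$ define $$B_p=\sum_{n=0}^\infty\left[\left(\int_0^{\lambda_1}\zeta_n(u)\,du\right)Z_n\,e_++\left(\int_0^{\lambda_2}\zeta_n(u)\,du\right)W_n\,e_-\right],$$ the series of $e_+$-components converging in $L^2(P_1)$ and the series of $e_-$-components converging in $L^2(P_2)$. Then $(B_p)_{p\in\mathbb H}$ is an $\mathbb H$-valued Gaussian process with covariance function $$E_{\mathbb H}(B_pB_q)=\tfrac12\left(|p|_{\mathbb H}+|q|_{\mathbb H}-|p-q|_{\mathbb H}\right),\qquad p,q\in\mathbb H.$$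
   Context: Hyperbolic numbers: $\mathbb H=\{a+bk: a,b\in\mathbb R\}$ with $k\notin\mathbb R$ commuting with the reals and $k^2=1$. Put $e_\pm=\frac{1\pm k}{2}$; then $e_\pm^2=e_\pm$, $e_+e_-=0$, $e_++e_-=1$, and each $p\in\mathbb H$ is uniquely $p=\lambda_1e_++\lambda_2e_-$ with $\lambda_1,\lambda_2\in\mathbb R$ (operations are componentwise). Set $|p|_{\mathbb H}=|\lambda_1|e_++|\lambda_2|e_-$. White noise measures: $\mathcal S_{\mathbb R}$ is the space of real-valued Schwartz functions on $\mathbb R$, $\mathcal S'_{\mathbb R}$ its dual, $\mathcal C$ the cylinder $\sigma$-algebra of $\mathcal S'_{\mathbb R}$, and $\widehat s(u)=\int_{\mathbb R}e^{-iut}s(t)\,dt$. For a positive measure $\sigma$ with $\int\frac{d\sigma(u)}{u^2+1}<\infty$, $P_\sigma$ is the unique probability measure on $(\mathcal S'_{\mathbb R},\mathcal C)$ (given by the Bochner–Minlos theorem) with $$e^{-\frac12\int_{\mathbb R}|\widehat s(u)|^2d\sigma(u)}=\int_{\mathcal S'_{\mathbb R}}e^{i\langle w,s\rangle}dP_\sigma(w),\quad s\in\mathcal S_{\mathbb R}.$$ $\mathcal H(\sigma)$ is the real Hilbert space completion of $\mathcal S_{\mathbb R}$ (modulo null vectors) for the inner product $\mathrm{Re}\int_{\mathbb R}\overline{\widehat{s_1}}\,\widehat{s_2}\,d\sigma$. The map $s\mapsto Q^\sigma_s$, $Q^\sigma_s(w)=\langle w,s\rangle$, is isometric from $\mathcal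 S_{\mathbb R}$ with this inner product into $L^2(\mathcal S'_{\mathbb R},\mathcal C,P_\sigma)$, and $Q^\sigma$ also denotes its extension to an isometry on $\mathcal H(\sigma)$. Normalized Hermite functions: $\zeta_n(x)=\frac{(-1)^n}{\pi^{1/4}2^{n/2}(n!)^{1/2}}e^{x^2/2}\left(\frac{d}{dx}\right)^ne^{-x^2}$, $n=0,1,2,\dots$ (an orthonormal basis of $L^2(\mathbb R,dx)$). Hyperbolic processes: for probability measures $P_1,P_2$ on a measurable space, $P_{\mathbb H}=P_1e_++P_2e_-$ is an $\mathbb H$-valued probability and $L^2(P_{\mathbb H})=L^2(P_1)e_+\oplus L^2(P_2)e_-$. For $X=X_1e_++X_2e_-$, $E_{\mathbb H}(X)=E_{P_1}(X_1)e_++E_{P_2}(X_2)e_-$. A second-order $\mathbb H$-valued process $X(p)=X_1(p)e_++X_2(p)e_-$, $p\in\mathbb H$, with values in $L^2(P_{\mathbb H})$ has covariance function $E_{\mathbb H}(X(p)X(q))=E_{P_1}(X_1(p)X_1(q))e_++E_{P_2}(X_2(p)X_2(q))e_-$. It is Gaussian if $X_1$ is a Gaussian process with respect to $P_1$ and $X_2$ is a Gaussian process with respect to $P_2$. *)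

(* Defs.v *)
From HB Require Import structures.
From mathcomp Require Import all_boot all_order all_algebra.
From mathcomp Require Import all_classical all_reals all_analysis.
From mathcomp Require Import complex.
From mathcomp Require Import ring lra.

Set Implicit Arguments.
Unset Strict Implicit.
Unset Printing Implicit Defensive.

Import Order.TTheory GRing.Theory Num.Theory.
Import numFieldNormedType.Exports.

Local Open Scope classical_set_scope.
Local Open Scope ring_scope.
Local Open Scope complex_scope.

(* [Hyperbolic a b] stands for a + b k, with k^2 = 1. *)
Record hyperbolic (R : realType) := Hyperbolic { hre : R; hhyp : R }.

Section hyperbolic_ring.
Context {R : realType}.
Implicit Types p q r : hyperbolic R.

Definition pair_of_hyp p : R * R := (hre p, hhyp p).
Definition hyp_of_pair (x : R * R) : hyperbolic R := Hyperbolic x.1 x.2.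
Lemma pair_of_hypK : cancel pair_of_hyp hyp_of_pair. Proof. by case. Qed.

HB.instance Definition _ := Choice.copy (hyperbolic R) (can_type pair_of_hypK).

Lemma hypP p q : hre p = hre q -> hhyp p = hhyp q -> p = q.
Proof. by case: p => a b; case: q => c d /= -> ->. Qed.

Definition hzero : hyperbolic R := Hyperbolic 0 0.
Definition hopp p := Hyperbolic (- hre p) (- hhyp p).
Definition hadd p q := Hyperbolic (hre p + hre q) (hhyp p + hhyp q).
Definition hone : hyperbolic R := Hyperbolic 1 0.
Definition hmul p q :=
  Hyperbolic (hre p * hre q + hhyp p * hhyp q) (hre p * hhyp q + hhyp p * hre q).
Definition hscale (c : R) p := Hyperbolic (c * hre p) (c * hhyp p).

Lemma haddA : associative hadd.
Proof. by move=> p q r; apply: hypP => /=; ring. Qed.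
Lemma haddC : commutative hadd.
Proof. by move=> p q; apply: hypP => /=; ring. Qed.
Lemma hadd0 : left_id hzero hadd.
Proof. by move=> p; apply: hypP => /=; ring. Qed.
Lemma haddN : left_inverse hzero hopp hadd.
Proof. by move=> p; apply: hypP => /=; ring. Qed.

HB.instance Definition _ :=
  GRing.isZmodule.Build (hyperbolic R) haddA haddC hadd0 haddN.

Lemma hmulA : associative hmul.
Proof. by move=> p q r; apply: hypP => /=; ring. Qed.
Lemma hmulC : commutative hmul.
Proof. by move=> p q; apply: hypP => /=; ring. Qed.
Lemma hmul1 : left_id hone hmul.
Proof. by move=> p; apply: hypP => /=; ring. Qed.
Lemma hmulDl : left_distributive hmul hadd.
Proof. by move=> p q r; apply: hypP => /=; ring. Qed.
Lemma hone_neq0 : hone != 0.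
Proof. by apply/eqP => -[] /eqP; rewrite oner_eq0. Qed.

HB.instance Definition _ := GRing.Zmodule_isComNzRing.Build (hyperbolic R)
  hmulA hmulC hmul1 hmulDl hone_neq0.

Lemma hscaleA a b p : hscale a (hscale b p) = hscale (a * b) p.
Proof. by apply: hypP => /=; ring. Qed.
Lemma hscale1 : left_id 1 hscale.
Proof. by move=> p; apply: hypP => /=; ring. Qed.
Lemma hscaleDr : right_distributive hscale +%R.
Proof. by move=> c p q; apply: hypP => /=; ring. Qed.
Lemma hscaleDl p : {morph hscale^~ p : a b / a + b}.
Proof. by move=> a b; apply: hypP => /=; ring. Qed.

HB.instance Definition _ := GRing.Zmodule_isLmodule.Build R (hyperbolic R)
  hscaleA hscale1 hscaleDr hscaleDl.

Definition hk : hyperbolic R := Hyperbolic 0 1.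
Definition eplus : hyperbolic R := (1 / 2 : R) *: (1 + hk).
Definition eminus : hyperbolic R := (1 / 2 : R) *: (1 - hk).

Definition hplus p : R := hre p + hhyp p.
Definition hminus p : R := hre p - hhyp p.

Lemma hkE : hk * hk = 1.
Proof. by apply: hypP => /=; ring. Qed.

Lemma eplus_idem : eplus * eplus = eplus.
Proof. by apply: hypP => /=; field. Qed.

Lemma eminus_idem : eminus * eminus = eminus.
Proof. by apply: hypP => /=; field. Qed.

Lemma eplus_eminus : eplus * eminus = 0.
Proof. by apply: hypP => /=; field. Qed.

Lemma eplusDeminus : eplus + eminus = 1.
Proof. by apply: hypP => /=; field. Qed.

Lemma hyp_decomp p : p = hplus p *: eplus + hminus p *: eminus.
Proof. by apply: hypP => /=; rewrite /hplus /hminus; field. Qed.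

Lemma hplusE (a b : R) : hplus (a *: eplus + b *: eminus) = a.
Proof. by rewrite /hplus /=; field. Qed.

Lemma hminusE (a b : R) : hminus (a *: eplus + b *: eminus) = b.
Proof. by rewrite /hminus /=; field. Qed.

Definition habs p : hyperbolic R :=
  `|hplus p| *: eplus + `|hminus p| *: eminus.

End hyperbolic_ring.

Section schwartz_space.
Context {R : realType}.

Definition is_schwartz (f : R -> R) : Prop :=
  (forall n x, derivable (derive1n n f) x 1) /\
  (forall a b : nat, exists C : R, forall x, `|x ^+ a * (derive1n b f) x| <= C).

Definition schwartz_pred : {pred (R -> R)} := fun f => `[< is_schwartz f >].

Lemma derive1n_lin (c : R) (f g : R -> R) n :
  (forall n x, derivable (derive1n n f) x 1) ->
  (forall n x, derivable (derive1n n g) x 1) ->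
  derive1n n (c *: f + g) = c *: derive1n n f + derive1n n g.
Proof.
move=> df dg; elim: n => [|n IH]; first by [].
rewrite !derive1nS IH; apply/funext => x /=.
have dcf : derivable (c *: derive1n n f) x 1 by apply: derivableZ; exact: df.
rewrite !fctE !derive1E (deriveD dcf (dg n x)).
by rewrite (deriveZ c (df n x)).
Qed.

Lemma schwartz_submod_closed : submod_closed schwartz_pred.
Proof.
have lin c f g : is_schwartz f -> is_schwartz g -> is_schwartz (c *: f + g).
  move=> [df bf] [dg bg]; split=> [n x|a b].
    rewrite derive1n_lin//; apply: derivableD; last exact: dg.
    by apply: derivableZ; exact: df.
  have [C1 hC1] := bf a b; have [C2 hC2] := bg a b.
  exists (`|c| * C1 + C2) => x; rewrite derive1n_lin// !fctE.
  rewrite mulrDr (le_trans (ler_normD _ _))// lerD//.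
  have -> : x ^+ a * (c *: derive1n b f x) = c * (x ^+ a * derive1n b f x).
    by rewrite /GRing.scale /=; ring.
  by rewrite normrM ler_wpM2l.
have d0 n : derive1n n (0 : R -> R) = 0.
  elim: n => [//|n IH]; rewrite derive1nS IH.
  by apply/funext => x; rewrite derive1E derive_cst.
split.
  apply/asboolP; split=> [n x|a b]; rewrite d0; first exact: derivable_cst.
  by exists 0 => x; rewrite mulr0 normr0.
by move=> c f g /asboolP fS /asboolP gS; apply/asboolP; exact: lin.
Qed.

HB.instance Definition _ :=
  GRing.isSubmodClosed.Build R (R -> R) schwartz_pred schwartz_submod_closed.

Record schwartz := Schwartz {
  schwartz_fun :> R -> R ;
  schwartzP : schwartz_fun \in schwartz_pred }.

HB.instance Definition _ := [isSub for schwartz_fun].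
HB.instance Definition _ := [Choice of schwartz by <:].
HB.instance Definition _ := [SubChoice_isSubLmodule of schwartz by <:].

(* The balls around f of the increasing sequence of norms
   max_(a, b <= N) sup_x |x^a f^(b)(x)|, which define the Frechet topology. *)
Definition schwartz_ball (N : nat) (f : schwartz) (e : R) : set schwartz :=
  [set g | forall a b x, (a <= N)%N -> (b <= N)%N ->
             `|x ^+ a * derive1n b ((g - f : schwartz) : R -> R) x| <= e].

Definition schwartz_nbhs (f : schwartz) : set_system schwartz :=
  [set A | exists N e, 0 < e /\ schwartz_ball N f e `<=` A].

HB.instance Definition _ := hasNbhs.Build schwartz schwartz_nbhs.

Lemma schwartz_derivable (f : schwartz) n x :
  derivable (derive1n n (f : R -> R)) x 1.
Proof. by have /asboolP[] := schwartzP f. Qed.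

Lemma schwartz_derive1nD (f g : schwartz) n :
  derive1n n ((f + g : schwartz) : R -> R) =
  derive1n n (f : R -> R) + derive1n n (g : R -> R).
Proof.
have := derive1n_lin 1 n (@schwartz_derivable f) (@schwartz_derivable g).
by rewrite !scale1r.
Qed.

Lemma schwartz_ball_center N f e : 0 < e -> schwartz_ball N f e f.
Proof.
move=> e0 a b x _ _; rewrite subrr.
have -> : derive1n b ((0 : schwartz) : R -> R) = 0; last
  by rewrite mulr0 normr0 ltW.
have := schwartz_derive1nD 0 0 b; rewrite addr0 => /eqP.
by rewrite -subr_eq0 opprD addNKr oppr_eq0 => /eqP.
Qed.

Lemma schwartz_nbhs_filter f : ProperFilter (schwartz_nbhs f).
Proof.
split.
  by move=> [N [e [e0 /(_ f)]]]; apply; exact: schwartz_ball_center.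
split.
- by exists 0%N, 1.
- move=> A B [N [e [e0 NA]]] [M [d [d0 MB]]].
  exists (maxn N M), (Num.min e d); split; first by rewrite lt_min e0 d0.
  move=> g gb; split; [apply: NA|apply: MB] => a b x aN bN;
    have := gb a b x; rewrite !leq_max aN bN ?orbT => /(_ isT isT);
    by rewrite le_min => /andP[].
- move=> A B AB [N [e [e0 NA]]]; exists N, e; split => //.
  exact: subset_trans AB.
Qed.

Lemma schwartz_nbhs_singleton f A : schwartz_nbhs f A -> A f.
Proof. by move=> [N [e [e0]]]; apply; exact: schwartz_ball_center. Qed.

Lemma schwartz_nbhs_nbhs f A :
  schwartz_nbhs f A -> schwartz_nbhs f (schwartz_nbhs^~ A).
Proof.
move=> [N [e [e0 NA]]]; exists N, (e / 2); split; first by rewrite divr_gt0.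
move=> g gf; exists N, (e / 2); split; first by rewrite divr_gt0.
move=> h hg; apply: NA => a b x aN bN.
have -> : h - f = (h - g) + (g - f) by rewrite addrA subrK.
rewrite schwartz_derive1nD fctE mulrDr (splitr e).
by rewrite (le_trans (ler_normD _ _))// lerD//; [exact: hg|exact: gf].
Qed.

HB.instance Definition _ := Nbhs_isNbhsTopological.Build schwartz
  schwartz_nbhs_filter schwartz_nbhs_singleton schwartz_nbhs_nbhs.

Record tempered := Tempered {
  tempered_fun :> {linear schwartz -> R^o} ;
  tempered_continuous : continuous (tempered_fun : schwartz -> R^o) }.

HB.instance Definition _ := gen_eqMixin tempered.
HB.instance Definition _ := gen_choiceMixin tempered.

Lemma tempered0_continuous : continuous ((\0)%R : schwartz -> R^o).
Proof. exact: (@cst_continuous schwartz R^o 0). Qed.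

HB.instance Definition _ :=
  isPointed.Build tempered (@Tempered (\0)%R tempered0_continuous).

(* Cylinders over one test function; they generate the same sigma-algebra as
   the cylinders over finitely many test functions. *)
Definition cylinder : set (set tempered) :=
  [set A | exists (s : schwartz) (B : set R),
     measurable B /\ A = [set w : tempered | B (w s)]].

End schwartz_space.
Arguments schwartz : clear implicits.
Arguments tempered : clear implicits.

Notation temperedM R := (g_sigma_algebraType (@cylinder R)).

Section fourier.
Context {R : realType}.

Definition expi (t : R) : R[i] := cos t +i* sin t.

Definition cintegral d (T : measurableType d) (mu : {measure set T -> \bar R})
    (f : T -> R[i]) : R[i] :=
  (\int[mu]_x complex.Re (f x))%R +i* (\int[mu]_x complex.Im (f x))%R.

Definition fourier (s : schwartz R) (u : R) : R[i] :=
  cintegral lebesgue_measure (fun t => expi (- (u * t)) * (s t)%:C).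

End fourier.

Section white_noise.
Context {R : realType}.

Definition growth_condition (sigma : {measure set (measurableTypeR R) -> \bar R}) :=
  (\int[sigma]_u ((u ^+ 2 + 1)^-1)%:E < +oo)%E.

Definition schwartz_form (sigma : {measure set (measurableTypeR R) -> \bar R})
    (s1 s2 : schwartz R) : R :=
  complex.Re (cintegral sigma (fun u => (fourier s1 u)^*%C * fourier s2 u)).

Definition is_white_noise_measure
    (sigma : {measure set (measurableTypeR R) -> \bar R})
    (P : probability (temperedM R) R) :=
  forall s : schwartz R,
    (expR (- (1 / 2 * (\int[sigma]_u (Normc.normc (fourier s u) ^+ 2))%R)))%:C
    = cintegral P (fun w : temperedM R => expi ((w : tempered R) s)).

End white_noise.

(* A completion of (V, form) modulo null vectors: a real Hilbert space with a
   linear form-preserving map from V with dense range. It is unique up to a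
   unique isometry, and u, v in V with form (u - v) (u - v) = 0 are identified
   by [hc_embed]. *)
Record hilbert_completion (R : realType) (V : lmodType R) (form : V -> V -> R) :=
  HilbertCompletion {
    hc_space :> completeNormedModType R ;
    hc_dot : hc_space -> hc_space -> R ;
    hc_dotC : forall x y, hc_dot x y = hc_dot y x ;
    hc_dotDl : forall x y z, hc_dot (x + y) z = hc_dot x z + hc_dot y z ;
    hc_dotZl : forall (a : R) x y, hc_dot (a *: x) y = a * hc_dot x y ;
    hc_dot_norm : forall x, hc_dot x x = `|x| ^+ 2 ;
    hc_embed : {linear V -> hc_space} ;
    hc_embed_dot : forall u v, hc_dot (hc_embed u) (hc_embed v) = form u v ;
    hc_embed_dense : dense (range hc_embed) }.

Definition white_noise_hilbert (R : realType)
    (sigma : {measure set (measurableTypeR R) -> \bar R}) :=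
  hilbert_completion (schwartz_form sigma).

Definition separable_space (T : topologicalType) :=
  exists2 D : set T, countable D & dense D.

Definition infinite_dimensional (R : realType) (V : lmodType R) :=
  forall n, exists v : 'I_n -> V,
    forall a : 'I_n -> R, \sum_i a i *: v i = 0 -> forall i, a i = 0.

Definition orthonormal_basis (R : realType) (V : lmodType R)
    (form : V -> V -> R) (H : hilbert_completion form) (e : nat -> H) :=
  (forall m n, hc_dot (e m) (e n) = (m == n)%:R) /\
  dense [set x : H | exists N (a : nat -> R), x = \sum_(n < N) a n *: e n].

Section isometry.
Context {R : realType}.

(* Functions in L^2(P) are represented by square integrable random variables;
   [Q] is determined up to P-almost sure equality, by density. *)
Definition is_white_noise_isometry
    (sigma : {measure set (measurableTypeR R) -> \bar R})
    (P : probability (temperedM R) R) (H : white_noise_hilbert sigma)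
    (Q : H -> temperedM R -> R) :=
  [/\ forall h, Q h \in Lfun P 2%:E,
      forall s : schwartz R,
        {ae P, forall w, Q (hc_embed H s) w = (w : tempered R) s}
    & forall h h', ('N[P]_2%:E[EFin \o (Q h \- Q h')%R] = `|h - h'|%:E)%E].

End isometry.

Section hermite.
Context {R : realType}.

Definition hermite_function (n : nat) (x : R) : R :=
  (-1) ^+ n / (pi `^ (1 / 4) * 2 `^ (n%:R / 2) * (n`!%:R) `^ (1 / 2)) *
  expR (x ^+ 2 / 2) * derive1n n (fun y : R => expR (- y ^+ 2)) x.

Definition oriented_integral (f : R -> R) (a b : R) : R :=
  if a <= b then (\int[lebesgue_measure]_(x in `[a, b]) f x)%R
  else - (\int[lebesgue_measure]_(x in `[b, a]) f x)%R.

End hermite.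

Section processes.
Context {R : realType} d {T : measurableType d}.

(* A variance zero normal law is a Dirac mass, whereas [normal_prob m 0] is
   the uniform law on [0, 1]. *)
Definition gaussian_rv (P : probability T R) (X : T -> R) :=
  measurable_fun setT X /\
  exists m s : R, 0 <= s /\
    forall A : set (measurableTypeR R), measurable A ->
      pushforward P X A = (if s == 0 then dirac m A else normal_prob m s A).

Definition gaussian_process (I : Type) (P : probability T R)
    (X : I -> T -> R) :=
  forall n (t : 'I_n -> I) (a : 'I_n -> R),
    gaussian_rv P (fun w => \sum_i a i * X (t i) w).

Definition hL2 (P1 P2 : probability T R) (X : T -> hyperbolic R) :=
  hplus \o X \in Lfun P1 2%:E /\ hminus \o X \in Lfun P2 2%:E.

Definition hL2_cvg (P1 P2 : probability T R) (X : nat -> T -> hyperbolic R)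
    (Y : T -> hyperbolic R) :=
  ((fun N => 'N[P1]_2%:E[EFin \o (fun w => hplus (X N w) - hplus (Y w))%R])%E
    @ \oo --> 0%E) /\
  ((fun N => 'N[P2]_2%:E[EFin \o (fun w => hminus (X N w) - hminus (Y w))%R])%E
    @ \oo --> 0%E).

Definition hexpectation (P1 P2 : probability T R) (X : T -> hyperbolic R) :
    hyperbolic R :=
  fine ('E_P1[hplus \o X])%E *: eplus + fine ('E_P2[hminus \o X])%E *: eminus.

Definition hcovariance (I : Type) (P1 P2 : probability T R)
    (X : I -> T -> hyperbolic R) (p q : I) : hyperbolic R :=
  hexpectation P1 P2 (fun w => X p w * X q w).

Definition hgaussian_process (I : Type) (P1 P2 : probability T R)
    (X : I -> T -> hyperbolic R) :=
  [/\ forall p, hL2 P1 P2 (X p),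
      gaussian_process P1 (fun p w => hplus (X p w))
    & gaussian_process P2 (fun p w => hminus (X p w))].

Definition hermite_partial_sum (Z W : nat -> T -> R) (p : hyperbolic R)
    (N : nat) (w : T) : hyperbolic R :=
  \sum_(n < N)
    ((oriented_integral (hermite_function n) 0 (hplus p) * Z n w) *: eplus +
     (oriented_integral (hermite_function n) 0 (hminus p) * W n w) *: eminus).

End processes.

(* Main.v *)
(* Polarizing the isometry property gives E[Q_x Q_y] = <x, y>, so Q is linear up
   to null sets. Approximating x by Schwartz functions shows that Q_x has the
   characteristic function exp(-|x|^2 t^2 / 2), hence is N(0, |x|^2).
   The components of B_p are Q_b for the vectors b = sum_n (int_0^l zeta_n) g_n,
   so the process is Gaussian and its covariance reduces to the Parseval identity
   sum_n (int_a^b zeta_n)^2 = b - a. The latter follows from Mehler's formula: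
   sum_n r^n zeta_n(x) zeta_n(y) is an approximate identity as r -> 1. *)
Require Import Defs.
From mathcomp Require Import all_boot all_order all_algebra.
From mathcomp Require Import all_classical all_reals all_analysis.
From mathcomp Require Import measurable_realfun complex.
From mathcomp Require Import ring lra.

Set Implicit Arguments.
Unset Strict Implicit.
Unset Printing Implicit Defensive.

Import Order.TTheory GRing.Theory Num.Theory.
Import numFieldNormedType.Exports.

Local Open Scope classical_set_scope.
Local Open Scope ring_scope.

(** The isometry hypothesis gives only distances and values on test functions, and processes are
    fixed only up to null sets. Hence properties of Q are read off second moments, and Gaussianity
    is proved for any variable almost surely equal to some Q_h. A law is identified from its
    characteristic function by smoothing with N(0, e^2): a normal density is its own Fourier
    transform up to scaling, so the smoothed law is explicit, and e then tends to 0. One-sided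
    estimates suffice because two measures of total mass 1 are compared. Parseval is required only
    for integrals of zeta_n over intervals. Integrating the expansion term by term at r = 1 lacks a
    majorant; the damping r^n provides one, since on compact sets zeta_n is bounded by K rho^n for
    every rho > 1. The same growth bound makes the generating series differentiable for |r| < 1, so
    that Mehler's formula follows from a linear differential equation in r. *)

Section Rintegral_extra.
Context d (T : measurableType d) (R : realType).
Variables (mu : {measure set T -> \bar R}) (D : set T).
Hypothesis mD : measurable D.
Implicit Types f g : T -> R.

Lemma integrableZl_EFin f (k : R) : mu.-integrable D (EFin \o f) ->
  mu.-integrable D (EFin \o (fun x => k * f x)).
Proof. exact: integrableZl. Qed.

Lemma integrableD_EFin f g : mu.-integrable D (EFin \o f) ->
  mu.-integrable D (EFin \o g) ->
  mu.-integrable D (EFin \o (fun x => f x + g x)).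
Proof. exact: integrableD. Qed.

Lemma integrableB_EFin f g : mu.-integrable D (EFin \o f) ->
  mu.-integrable D (EFin \o g) ->
  mu.-integrable D (EFin \o (fun x => f x - g x)).
Proof. exact: integrableB. Qed.

Lemma le_integrable_EFin f g : measurable_fun D f ->
  (forall x, D x -> `|f x| <= g x) -> mu.-integrable D (EFin \o g) ->
  mu.-integrable D (EFin \o f).
Proof.
move=> mf fg; apply: le_integrable => //; first exact/measurable_EFinP.
by move=> x Dx; rewrite lee_fin (le_trans (fg x Dx)) ?ler_norm.
Qed.

(** Integrability of the limit belongs to the conclusion: for the Mehler kernel and its partial
    integrals it is obtained through the partial sums. *)
Lemma Rdominated_cvg (u : nat -> T -> R) f g :
  (forall n, measurable_fun D (u n)) ->
  (forall x, D x -> u n x @[n --> \oo] --> f x) ->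
  mu.-integrable D (EFin \o g) ->
  (forall n x, D x -> `|u n x| <= g x) ->
  mu.-integrable D (EFin \o f) /\
  \int[mu]_(x in D) u n x @[n --> \oo] --> \int[mu]_(x in D) f x.
Proof.
move=> mu_ uf ig ug.
have mf : measurable_fun D f by exact: (@measurable_fun_cvg _ _ _ _ u).
have iu n : mu.-integrable D (EFin \o u n).
  by apply: le_integrable_EFin (ug n) ig.
have if_ : mu.-integrable D (EFin \o f).
  apply: le_integrable_EFin ig => // x Dx.
  have cn : `|u n x| @[n --> \oo] --> `|f x| by apply: cvg_norm; exact: uf.
  rewrite -(cvg_lim _ cn)//; apply: limr_le; first by apply/cvg_ex; exists `|f x|.
  by apply: nearW => n; exact: ug.
split => //.
apply: fine_cvg; rewrite fineK; last exact: integrable_fin_num.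
apply: (@dominated_cvg _ _ _ mu D mD (fun n => EFin \o u n) (EFin \o f) (EFin \o g)).
- by move=> n; exact/measurable_EFinP.
- by move=> x Dx; apply: cvg_EFin; [exact: nearW|exact: uf].
- by [].
- exact: ig.
- by move=> n x Dx; rewrite lee_fin ug.
Qed.

End Rintegral_extra.

(** * Laws determined by characteristic functions *)

Section normal_characteristic_function.
Context {R : realType}.
Local Notation mu := (@lebesgue_measure R).

(** Fundamental theorem of calculus on growing symmetric intervals, then dominated convergence. It
    allows integration by parts against the normal density without boundary terms. *)
Lemma Rintegral_derive0 (F f : R -> R) :
  (forall x : R, is_derive x (1 : R) F (f x)) -> continuous f ->
  mu.-integrable setT (EFin \o f) ->
  F n.+1%:R @[n --> \oo] --> 0 -> F (- n.+1%:R) @[n --> \oo] --> 0 ->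
  \int[mu]_x f x = 0.
Proof.
move=> dF cf intf F0 FN0.
have mf : measurable_fun setT f by exact: continuous_measurable_fun.
(* The bounds use [n.+1] so that the interval is nondegenerate already for [n = 0]. *)
pose D (n : nat) : set R := `[(- n.+1%:R), n.+1%:R]%classic.
have FTC (n : nat) : (\int[mu]_(x in D n) (f x)%:E =
    (F n.+1%:R - F (- n.+1%:R))%:E)%E.
  rewrite EFinB; apply: continuous_FTC2.
  - by rewrite gtrN.
  - exact: continuous_subspaceT.
  - split.
    + by move=> x _; have [] := dF x.
    + apply: cvg_at_right_filter; apply: differentiable_continuous.
      by apply/derivable1_diffP; have [] := dF (- n.+1%:R).
    + apply: cvg_at_left_filter; apply: differentiable_continuous.
      by apply/derivable1_diffP; have [] := dF n.+1%:R.
  - by move=> x _; rewrite derive1E; have [_ ->] := dF x.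
have cv1 : (\int[mu]_(x in D n) (f x)%:E)%E @[n --> \oo] -->
    (\int[mu]_x (f x)%:E)%E.
  under eq_fun do rewrite integral_mkcond.
  apply: (@dominated_cvg _ _ _ mu _ measurableT _ _ (abse \o EFin \o f)) => //=.
  - move=> n; apply/(measurable_restrictT _ _).1 => //; first exact: measurable_itv.
    by apply: measurable_funTS; exact/measurable_EFinP.
  - move=> x _; apply: cvg_near_cst.
    near=> n; rewrite patchE ifT// inE /D /= in_itv/= -ler_norml.
    rewrite (@le_trans _ _ n%:R) ?ler_nat//.
    near: n; exact: nbhs_infty_ger.
  - exact: integrable_abse.
  - move=> n x _; rewrite /patch; case: ifP => _ //=; rewrite normr0 lee_fin//.
have cv2 : (\int[mu]_(x in D n) (f x)%:E)%E @[n --> \oo] --> 0%:E.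
  under eq_fun do rewrite FTC.
  apply: cvg_EFin; first exact: nearW.
  rewrite -[X in _ --> X](subrr 0).
  exact: cvgB.
by rewrite /Rintegral (cvg_unique _ cv1 cv2).
Unshelve. all: by end_near. Qed.

Variable s : R.
Hypothesis s0 : 0 < s.
Local Notation phi := (normal_pdf 0 s).

Let phiE (x : R) : phi x = normal_peak s * normal_fun 0 s x.
Proof. by rewrite normal_pdfE ?gt_eqF. Qed.

Let is_derive_phi (x : R) : is_derive x (1 : R) phi (- (x / s ^+ 2 * phi x)).
Proof.
have h : is_derive x (1 : R) (fun y : R => - (y - 0) ^+ 2 / (s ^+ 2 *+ 2)) (- (x / s ^+ 2)).
  by apply: is_derive_eq; rewrite /GRing.scale /=; field; rewrite gt_eqF.
have h' := is_derive1_comp (is_derive_expR _) h.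
have -> : phi = (fun x => normal_peak s * (expR \o (fun y : R => - (y - 0) ^+ 2 / (s ^+ 2 *+ 2))) x).
  by apply/funext => z; rewrite phiE.
by apply: is_derive_eq; rewrite /GRing.scale /=; ring.
Qed.

Let phi_ge0 (x : R) : 0 <= phi x. Proof. exact: normal_pdf_ge0. Qed.

(** Writing 1/2 = 1/8 + 3/8 in the exponent splits off a normal profile of deviation [2 * s]; the
    other factor absorbs u = |x| / s because u <= 1 + u^2 / 4 <= exp(3 u^2 / 8). Both the
    integrability of |x| phi(x) and the decay of phi come from this bound. *)
Let abs_mul_phi_le (x : R) : `|x| * phi x <= normal_peak s * s * normal_fun 0 (2 * s) x.
Proof.
rewrite phiE mulrCA -mulrA ler_wpM2l ?normal_peak_ge0//.
have -> : normal_fun 0 s x = normal_fun 0 (2 * s) x * expR (- (3 / 8 * (x / s) ^+ 2)).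
  by rewrite -expRD /normal_fun; congr expR; field; rewrite gt_eqF.
rewrite mulrCA [leRHS]mulrC ler_wpM2l ?expR_ge0// expRN ler_pdivrMr ?expR_gt0//.
rewrite mulrC -ler_pdivrMr// (le_trans _ (expR_ge1Dx _))//.
have -> : `|x| / s = `|x / s| by rewrite normrM normfV (gtr0_norm s0).
have : 0 <= (`|x / s| / 2 - 1) ^+ 2 by exact: sqr_ge0.
rewrite -(real_normK (num_real (x / s))).
set u := `|x / s|; have : 0 <= u ^+ 2 by exact: sqr_ge0.
move=> h1 h2; lra.
Qed.

Let integrable_phi : mu.-integrable setT (EFin \o phi).
Proof. exact: integrable_normal_pdf. Qed.

Let measurable_phi : measurable_fun setT phi.
Proof. exact: measurable_normal_pdf. Qed.

Let integrable_mulid_phi : mu.-integrable setT (EFin \o (fun x => `|x| * phi x)).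
Proof.
have p0 : (0 : R) < normal_peak (2 * s) by rewrite normal_peak_gt0// mulf_neq0// gt_eqF.
have nint := @integrable_normal_pdf R 0 (2 * s).
apply: (le_integrable_EFin measurableT _ _
  (integrableZl_EFin measurableT (normal_peak s * s / normal_peak (2 * s)) nint)).
  by apply: measurable_funM => //; exact: measurableT_comp.
move=> x _; rewrite ger0_norm ?mulr_ge0//.
rewrite (le_trans (abs_mul_phi_le _))// normal_pdfE ?mulf_neq0 ?gt_eqF//.
by rewrite mulrA divfK ?gt_eqF.
Qed.

Let cosG (y : R) : R := \int[mu]_x (cos (y * x) * phi x).
Let sinG (y : R) : R := \int[mu]_x (x * sin (y * x) * phi x).

Let integrable_cosG (y : R) :
  mu.-integrable setT (EFin \o (fun x => cos (y * x) * phi x)).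
Proof.
apply: (le_integrable_EFin measurableT _ _ integrable_phi) => [|x _].
  apply: measurable_funM => //.
  apply: (@measurableT_comp _ _ _ _ _ _ (@cos R)); last exact: measurable_funM.
  by apply: continuous_measurable_fun; exact: continuous_cos.
rewrite normrM (ger0_norm (phi_ge0 _)) ler_piMl//.
by rewrite ler_norml cos_geN1 cos_le1.
Qed.

Let measurable_sin_mul (y : R) : measurable_fun setT (fun x : R => sin (y * x)).
Proof.
apply: (@measurableT_comp _ _ _ _ _ _ (@sin R)); last exact: measurable_funM.
by apply: continuous_measurable_fun; exact: continuous_sin.
Qed.

Let integrable_sinG (y : R) :
  mu.-integrable setT (EFin \o (fun x => x * sin (y * x) * phi x)).
Proof.
apply: (le_integrable measurableT _ _ integrable_mulid_phi) => //=.
  apply/measurable_EFinP; apply: measurable_funM; last exact: measurable_phi.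
  by apply: measurable_funM => //; exact: measurable_sin_mul.
move=> x _; rewrite lee_fin !normrM normr_id ler_wpM2r// ler_piMr//.
by rewrite ler_norml sin_geN1 sin_le1.
Qed.

Let is_derive_cosG (y : R) : is_derive y (1 : R) cosG (- sinG y).
Proof.
pose f (y x : R) := cos (y * x) * phi x.
have df (z x : R) : is_derive z (1 : R) (f ^~ x) (- (x * sin (z * x) * phi x)).
  have h : is_derive z (1 : R) (fun z => z * x) x.
    by apply: is_derive_eq; rewrite /GRing.scale /=; ring.
  have h' := @is_derive1_comp _ cos _ _ _ _ (is_derive_cos _) h.
  by apply: is_derive_eq; rewrite /GRing.scale /=; ring.
have Iy : `](y - 1), (y + 1)[%classic y by rewrite /= in_itv/= ltrBlDr ltrDl ltr01.
have d1f (z x : R) : partial1of2 f z x = - (x * sin (z * x) * phi x).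
  by rewrite partial1of2E; have [_ ->] := df z x.
have ub (z x : R) : `|partial1of2 f z x| <= `|x| * phi x.
  rewrite d1f normrN !normrM (ger0_norm (phi_ge0 _)) ler_wpM2r ?phi_ge0//.
  by rewrite ler_piMr// ler_norml sin_geN1 sin_le1.
have g0 (x : R) : 0 <= `|x| * phi x by rewrite mulr_ge0 ?phi_ge0.
apply: DeriveDef.
  apply: (@derivable_under_integral _ _ _ mu f _ measurableT y (y - 1) (y + 1) Iy
    (fun z _ => integrable_cosG z) _ (fun x => `|x| * phi x) g0 integrable_mulid_phi) => //.
rewrite -derive1E.
rewrite (@differentiation_under_integral _ _ _ mu f _ measurableT y (y - 1) (y + 1) Iy
    (fun z _ => integrable_cosG z) _ (fun x => `|x| * phi x) g0 integrable_mulid_phi) => //.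
under eq_Rintegral do rewrite d1f -mulN1r.
by rewrite RintegralZl// mulN1r.
Qed.

Let cvg_sin_mul_phi (y : R) (u : nat -> R) :
  (forall n, `|u n| = n.+1%:R) ->
  s ^+ 2 * (sin (y * u n) * phi (u n)) @[n --> \oo] --> 0.
Proof.
move=> un; rewrite -[X in _ --> X](mulr0 (s ^+ 2)); apply: cvgMr; apply/norm_cvg0P.
apply: (@squeeze_cvgr _ _ _ _ (cst 0) (fun n => normal_peak s * s * n.+1%:R^-1)).
- near=> n; rewrite normr_ge0 normrM (ger0_norm (phi_ge0 _)) /=.
  rewrite (@le_trans _ _ (phi (u n)))//.
    by rewrite ler_piMl// ler_norml sin_geN1 sin_le1.
  rewrite ler_pdivlMr ?ltr0n// mulrC -un (le_trans (abs_mul_phi_le _))//.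
  rewrite ler_piMr ?mulr_ge0 ?normal_peak_ge0 ?(ltW s0)// -[leRHS]expR0 ler_expR.
  by rewrite mulNr oppr_le0 mulr_ge0 ?sqr_ge0// invr_ge0 mulrn_wge0 ?sqr_ge0.
- exact: cvg_cst.
- rewrite -[X in _ --> X](mulr0 (normal_peak s * s)); apply: cvgMr.
  exact: cvg_harmonic.
Unshelve. all: by end_near. Qed.

(** Integration by parts, using phi'(x) = - x phi(x) / s^2. *)
Let cosG_sinG (y : R) : sinG y = s ^+ 2 * y * cosG y.
Proof.
pose F (x : R) := s ^+ 2 * (sin (y * x) * phi x).
pose f (x : R) := s ^+ 2 * y * (cos (y * x) * phi x) - x * sin (y * x) * phi x.
have dF (x : R) : is_derive x (1 : R) F (f x).
  have h : is_derive x (1 : R) (fun x => y * x) y.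
    by apply: is_derive_eq; rewrite /GRing.scale /=; ring.
  have h' := @is_derive1_comp _ sin _ _ _ _ (is_derive_sin _) h.
  have h2 := is_derive_phi x.
  by apply: is_derive_eq; rewrite /f /GRing.scale /=; field; rewrite gt_eqF.
have cont : continuous f.
  move=> x; rewrite /f.
  have cy : (fun x : R => y * x) x @[x --> x] --> y * x by apply: cvgMr; exact: cvg_id.
  have cg : phi x @[x --> x] --> phi x by apply: continuous_normal_pdf; rewrite gt_eqF.
  have cs := cvg_comp _ _ cy (@continuous_sin R (y * x)).
  have cc := cvg_comp _ _ cy (@continuous_cos R (y * x)).
  apply: cvgB; first by apply: cvgMr; apply: cvgM.
  by apply: cvgM => //; apply: cvgM => //; exact: cvg_id.
have intf : mu.-integrable setT (EFin \o f).
  by apply: integrableB_EFin => //; exact: integrableZl_EFin.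
have := @Rintegral_derive0 F f dF cont intf _ _.
rewrite /f RintegralB// ?RintegralZl//; last exact: integrableZl_EFin.
move=> H; apply/esym/eqP; rewrite -subr_eq0; apply/eqP.
by apply: H; apply: cvg_sin_mul_phi => n; rewrite ?normrN normr_nat.
Qed.

(** The integral G satisfies G'(y) = - s^2 y G(y), so G(y) exp(s^2 y^2 / 2) is constant; at y = 0 it
    is the total mass 1. *)
Lemma Rintegral_cos_normal_pdf (y : R) :
  \int[mu]_x (cos (y * x) * phi x) = expR (- (s ^+ 2 * y ^+ 2 / 2)).
Proof.
pose h (y : R) := cosG y * expR (s ^+ 2 * y ^+ 2 / 2).
have dh (z : R) : is_derive z (1 : R) h 0.
  have dsq : is_derive z (1 : R) (fun z => s ^+ 2 * z ^+ 2 / 2) (s ^+ 2 * z).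
    by apply: is_derive_eq; rewrite /GRing.scale /=; field.
  have de := is_derive1_comp (is_derive_expR _) dsq.
  have dc := is_derive_cosG z.
  apply: is_derive_eq; rewrite /GRing.scale /= cosG_sinG; ring.
have h0 : h y = 1.
  rewrite (is_derive_0_is_cst y 0 dh) /h /cosG expr0n/= mulr0 mul0r expR0 mulr1.
  under eq_Rintegral do rewrite mul0r cos0 mul1r.
  by rewrite /Rintegral integral_normal_pdf.
apply: (mulIf (lt0r_neq0 (expR_gt0 (s ^+ 2 * y ^+ 2 / 2)))).
by rewrite -expRD addNr expR0; exact: h0.
Qed.
End normal_characteristic_function.

(** * Comparison of probabilities on the line *)

Section probability_unique.
Context {R : realType}.
Variables P N : probability (measurableTypeR R) R.
Hypothesis PN : forall c d : R, c < d -> (P `]c, d[%classic <= N `]c, d[%classic)%E.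

Let cvg_limn (Q : probability (measurableTypeR R) R) (F : (set (measurableTypeR R))^nat) :
  (forall i, measurable (F i)) -> nondecreasing_seq F ->
  (Q (F n) @[n --> \oo] --> Q (\bigcup_n F n))%E.
Proof.
by move=> mF ndF; apply: nondecreasing_cvg_mu => //; exact: bigcup_measurable.
Qed.

Let le_bigcup (F : (set (measurableTypeR R))^nat) :
  (forall i, measurable (F i)) -> nondecreasing_seq F ->
  (forall i, P (F i) <= N (F i))%E -> (P (\bigcup_n F n) <= N (\bigcup_n F n))%E.
Proof.
move=> mF ndF FPN.
rewrite -(cvg_lim _ (cvg_limn (Q := P) mF ndF))// -(cvg_lim _ (cvg_limn (Q := N) mF ndF))//.
apply: lee_lim.
- by apply/cvg_ex; eexists; exact: cvg_limn.
- by apply/cvg_ex; eexists; exact: cvg_limn.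
- exact: nearW.
Qed.

Let le_Nyo (d : R) : (P `]-oo, d[%classic <= N `]-oo, d[%classic)%E.
Proof.
have -> : `]-oo, d[%classic = \bigcup_n (`](d - n.+1%:R), d[%classic : set R).
  apply/seteqP; split => x /=; last by move=> [n _] /=; rewrite !in_itv/= => /andP[].
  rewrite in_itv/= => xd; exists (Num.truncn (d - x)) => //=.
  rewrite in_itv/= xd andbT ltrBlDr -ltrBlDl.
  by rewrite truncnS_gt.
apply: le_bigcup => //.
- move=> m n mn; apply/subsetPset => x /=; rewrite !in_itv/= => /andP[h ->].
  by rewrite andbT (le_lt_trans _ h)// lerD2l lerN2 ler_nat ltnS.
- by move=> n; apply: PN; rewrite ltrBlDr ltrDl ltr0n.
Qed.

Let le_oy (d : R) : (P `]d, +oo[%classic <= N `]d, +oo[%classic)%E.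
Proof.
have -> : `]d, +oo[%classic = \bigcup_n (`]d, (d + n.+1%:R)[%classic : set R).
  apply/seteqP; split => x /=; last first.
    by move=> [n _] /=; rewrite !in_itv/= andbT => /andP[].
  rewrite in_itv/= andbT => xd; exists (Num.truncn (x - d)) => //=.
  by rewrite in_itv/= xd/= -ltrBlDl truncnS_gt.
apply: le_bigcup => //.
- move=> m n mn; apply/subsetPset => x /=; rewrite !in_itv/= => /andP[-> h].
  by rewrite /= (lt_le_trans h)// lerD2l ler_nat ltnS.
- by move=> n; apply: PN; rewrite ltrDl ltr0n.
Qed.

(** The complement of an open right ray is a closed left ray, reached from open ones by continuity
    from above. *)
Let le_Nyc (d : R) : (P `]-oo, d]%classic <= N `]-oo, d]%classic)%E.
Proof.
pose F (n : nat) : set R := `]-oo, (d + n.+1%:R^-1)[%classic.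
have FE : `]-oo, d]%classic = \bigcap_n F n by rewrite (itvNycEbigcap true).
have cvF (Q : probability (measurableTypeR R) R) : (Q (F n) @[n --> \oo] --> Q (\bigcap_n F n))%E.
  apply: (@nonincreasing_cvg_mu _ _ _ Q F).
  - by rewrite (le_lt_trans (probability_le1 _ _)) ?ltry//; exact: measurable_itv.
  - by move=> i; exact: measurable_itv.
  - by rewrite -FE; exact: measurable_itv.
  - move=> m n mn; apply/subsetPset => x; rewrite /F /= !in_itv/= => h.
    by rewrite (lt_le_trans h)// lerD2l lef_pV2 ?posrE ?ltr0n// ler_nat ltnS.
rewrite FE -(cvg_lim _ (cvF P))// -(cvg_lim _ (cvF N))//.
apply: lee_lim; [by apply/cvg_ex; eexists; exact: cvF..|].
by apply: nearW => n; exact: le_Nyo.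
Qed.

(* Domination on open intervals passes to rays ]-oo, a] and ]a, +oo[; these are
   complementary and both total masses are 1, which forces equality. *)
Lemma probability_eq_of_le_oo A : measurable A -> P A = N A.
Proof.
apply: (@measure_unique _ R (measurableTypeR R) (@RGenOInfty.G R)
  (fun n => `](- n.+1%:R), +oo[%classic)).
- exact: RGenOInfty.measurableE.
- move=> _ _ [a ->] [b ->]; exists (Num.max a b).
  by apply/seteqP; split => x /=; rewrite !in_itv/= !andbT gt_max => /andP.
- by move=> n; eexists.
- apply/seteqP; split => // x _; exists (Num.truncn (- x)) => //=.
  by rewrite in_itv/= andbT ltrNl truncnS_gt.
- move=> _ [a ->]; apply/eqP; rewrite eq_le le_oy/=.
  have PC (Q : probability (measurableTypeR R) R) :
      Q `]a, +oo[%classic = (1 - Q `]-oo, a]%classic)%E.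
    by rewrite -probability_setC ?setCitvl//; exact: measurable_itv.
  by rewrite !PC leeB.
- by move=> k; rewrite (le_lt_trans (probability_le1 _ _)) ?ltry//; exact: measurable_itv.
Qed.

End probability_unique.

(** * Concentration of normal laws *)

Section normal_tail.
Context {R : realType}.
Local Notation mu := (@lebesgue_measure R).

Lemma normal_pdf_sym (x y s : R) : s != 0 -> normal_pdf x s y = normal_pdf y s x.
Proof.
by move=> s0; rewrite !normal_pdfE// /normal_fun -(sqrrN (y - x)) opprB.
Qed.

Lemma normal_peakE (s : R) : 0 < s -> normal_peak s = s^-1 * normal_peak 1.
Proof.
move=> s0; rewrite /normal_peak -mulrnAr sqrtrM ?sqr_ge0// sqrtr_sqr gtr0_norm//.
by rewrite invfM expr1n mul1r.
Qed.

(** Passing from deviation s to 2s leaves the factor exp(-3 u^2 / 8) with u >= r / s, which is at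
    most 8 s^2 / (3 r^2) <= 3 s^2 / r^2. The ratio 2 of the peaks turns 3 into 6. *)
Lemma normal_pdf_tail (m s r x : R) : 0 < s -> 0 < r -> r <= `|x - m| ->
  normal_pdf m s x <= 6 * s ^+ 2 / r ^+ 2 * normal_pdf m (2 * s) x.
Proof.
move=> s0 r0 rx; have s20 : 0 < 2 * s by rewrite mulr_gt0.
rewrite !normal_pdfE ?gt_eqF// (normal_peakE s0) (normal_peakE s20).
have -> : normal_fun m s x =
    normal_fun m (2 * s) x * expR (- (3 / 8 * (x - m) ^+ 2 / s ^+ 2)).
  by rewrite -expRD /normal_fun; congr expR; field; rewrite gt_eqF.
have e1 : expR (- (3 / 8 * (x - m) ^+ 2 / s ^+ 2)) <= 3 * s ^+ 2 / r ^+ 2.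
  have r2 : 0 < 3 / 8 * r ^+ 2 / s ^+ 2 by rewrite divr_gt0 ?exprn_gt0// mulr_gt0 ?exprn_gt0//; lra.
  rewrite expRN (@le_trans _ _ (3 / 8 * r ^+ 2 / s ^+ 2)^-1)//.
    rewrite lef_pV2 ?posrE ?expR_gt0//.
    apply: (@le_trans _ _ (3 / 8 * (x - m) ^+ 2 / s ^+ 2)).
      rewrite ler_pM2r ?invr_gt0 ?exprn_gt0// ler_pM2l; last lra.
      by rewrite -(real_normK (num_real (x - m))) lerXn2r ?nnegrE// ltW.
    by rewrite (le_trans _ (expR_ge1Dx _))// lerDr.
  have -> : (3 / 8 * r ^+ 2 / s ^+ 2)^-1 = 8 / 3 * (s ^+ 2 / r ^+ 2).
    by field; rewrite !gt_eqF.
  rewrite -[leRHS]mulrA ler_wpM2r ?divr_ge0 ?sqr_ge0//; lra.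
have -> : 6 * s ^+ 2 / r ^+ 2 * ((2 * s)^-1 * normal_peak 1 * normal_fun m (2 * s) x) =
  s^-1 * normal_peak 1 * (normal_fun m (2 * s) x * (3 * s ^+ 2 / r ^+ 2)).
  by field; rewrite !gt_eqF.
rewrite ler_wpM2l ?mulr_ge0 ?normal_peak_ge0 ?invr_ge0 ?(ltW s0)//.
by rewrite ler_wpM2l ?normal_fun_ge0.
Qed.

(** A Chebyshev-type bound, obtained by integrating the tail estimate against a density of mass 1.
    It controls both the smoothing of a law and the concentration of the Mehler kernel on the
    diagonal. *)
Lemma normal_prob_oo_ge (m s r a b : R) : 0 < s -> 0 < r ->
  a <= m - r -> m + r <= b ->
  ((1 - 6 * s ^+ 2 / r ^+ 2)%:E <= normal_prob m s `]a, b[%classic)%E.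
Proof.
move=> s0 r0 am mb.
have mab : measurable (`]a, b[%classic : set (measurableTypeR R)) by exact: measurable_itv.
rewrite -[X in normal_prob _ _ X]setCK.
have -> := @probability_setC _ _ _ (normal_prob m s) _ (measurableC mab).
rewrite EFinB leeB// /normal_prob.
pose K := 6 * s ^+ 2 / r ^+ 2.
have K0 : 0 <= K by rewrite divr_ge0 ?sqr_ge0// mulr_ge0 ?sqr_ge0.
apply: (@le_trans _ _ (\int[mu]_(x in ~` `]a, b[%classic) (K * normal_pdf m (2 * s) x)%:E)%E).
  apply: ge0_le_integral => //.
  - exact: measurableC.
  - by move=> x _; rewrite lee_fin normal_pdf_ge0.
  - by apply/measurable_EFinP/measurable_funTS; exact: measurable_normal_pdf.
  - by apply/measurable_EFinP/measurable_funTS/measurable_funM => //; exact: measurable_normal_pdf.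
  - move=> x /= xab; rewrite lee_fin; apply: normal_pdf_tail => //.
    rewrite leNgt; apply/negP; rewrite ltr_distl => /andP[h1 h2]; apply: xab.
    by rewrite in_itv/= (le_lt_trans am h1) (lt_le_trans h2 mb).
apply: (@le_trans _ _ (\int[mu]_x (K * normal_pdf m (2 * s) x)%:E)%E).
  apply: ge0_subset_integral => //; first exact: measurableC.
  - by apply/measurable_EFinP/measurable_funM => //; exact: measurable_normal_pdf.
  - by move=> x _; rewrite lee_fin mulr_ge0 ?normal_pdf_ge0.
under eq_integral do rewrite EFinM.
by rewrite integralZl ?integral_normal_pdf ?mule1//; exact: integrable_normal_pdf.
Qed.

End normal_tail.

(** * Smoothing a law by a normal density *)

Section smoothed_density.
Context {R : realType} d {T : measurableType d} (P : probability T R).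
Variables (X : T -> R) (s : R).
Hypothesis mX : measurable_fun setT X.
Hypothesis s0 : 0 < s.
Hypothesis ccos : forall t : R,
  \int[P]_w cos (t * X w) = expR (- (s ^+ 2 * t ^+ 2 / 2)).
Hypothesis csin : forall t : R, \int[P]_w sin (t * X w) = 0.
Local Notation mu := (@lebesgue_measure R).

Let measurable_cos (f : T -> R) : measurable_fun setT f -> measurable_fun setT (fun w => cos (f w)).
Proof.
move=> mf; apply: (@measurableT_comp _ _ _ _ _ _ (@cos R)) => //.
by apply: continuous_measurable_fun; exact: continuous_cos.
Qed.

Let measurable_sin (f : T -> R) : measurable_fun setT f -> measurable_fun setT (fun w => sin (f w)).
Proof.
move=> mf; apply: (@measurableT_comp _ _ _ _ _ _ (@sin R)) => //.
by apply: continuous_measurable_fun; exact: continuous_sin.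
Qed.

Let integrable_le1 (f : T -> R) : measurable_fun setT f -> (forall w, `|f w| <= 1) ->
  P.-integrable setT (EFin \o f).
Proof.
move=> mf f1; apply: (le_integrable_EFin measurableT mf (g := cst 1)) => //.
exact: finite_measure_integrable_cst.
Qed.

Let Rintegral_cos_shift (t y : R) :
  \int[P]_w cos ((X w - y) * t) = cos (y * t) * expR (- (s ^+ 2 * t ^+ 2 / 2)).
Proof.
under eq_Rintegral do rewrite mulrBl cosB (mulrC (cos (X _ * _))) (mulrC (sin (X _ * _)))
  !(mulrC (X _)).
have ic : P.-integrable setT (EFin \o (fun w => cos (t * X w))).
  apply: integrable_le1 => [|w]; last by rewrite ler_norml cos_geN1 cos_le1.
  by apply: measurable_cos; exact: measurable_funM.
have is_ : P.-integrable setT (EFin \o (fun w => sin (t * X w))).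
  apply: integrable_le1 => [|w]; last by rewrite ler_norml sin_geN1 sin_le1.
  by apply: measurable_sin; exact: measurable_funM.
rewrite RintegralD//; [|exact: integrableZl_EFin..].
by rewrite !RintegralZl// ccos csin mulr0 addr0.
Qed.

(* Up to a factor the density of N(y, e^2) is the Fourier transform of that of
   N(0, e^-2), so by Fubini the left-hand side only involves the characteristic
   function of X. *)
Lemma expectation_normal_pdf (e y : R) : 0 < e ->
  \int[P]_w normal_pdf y e (X w) = normal_pdf 0 (Num.sqrt (s ^+ 2 + e ^+ 2)) y.
Proof.
move=> e0; have ie0 : 0 < e^-1 by rewrite invr_gt0.
set tau := Num.sqrt _.
have tau2 : tau ^+ 2 = s ^+ 2 + e ^+ 2 by rewrite sqr_sqrtr ?addr_ge0 ?sqr_ge0.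
have tau0 : 0 < tau by rewrite sqrtr_gt0 addr_gt0 ?exprn_gt0.
have it0 : 0 < tau^-1 by rewrite invr_gt0.
pose f (z : T * R) : R := cos ((X z.1 - y) * z.2) * normal_pdf 0 e^-1 z.2.
have mf : measurable_fun setT (f : T * measurableTypeR R -> R).
  apply: measurable_funM.
    apply: (@measurableT_comp _ _ _ _ _ _ (@cos R)).
      by apply: continuous_measurable_fun; exact: continuous_cos.
    apply: measurable_funM => //; apply: measurable_funB => //.
    exact: measurableT_comp.
  by apply: measurableT_comp => //; exact: measurable_normal_pdf.
have fb (w : T) (x : R) : `|f (w, x)| <= normal_pdf 0 e^-1 x.
  rewrite /f normrM (ger0_norm (normal_pdf_ge0 _ _ _)) ler_piMl ?normal_pdf_ge0//.
  by rewrite ler_norml cos_geN1 cos_le1.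
have intphi (r : R) : mu.-integrable setT (EFin \o normal_pdf 0 r).
  exact: integrable_normal_pdf.
have intx (w : T) : mu.-integrable setT (EFin \o (fun x => f (w, x))).
  apply: (le_integrable_EFin measurableT _ _ (intphi e^-1)) => [|x _]; last exact: fb.
  by apply: measurableT_comp mf _; exact: measurable_pair1.
have intw (x : R) : P.-integrable setT (EFin \o (fun w => f (w, x))).
  apply: (@le_integrable_EFin _ _ _ _ _ measurableT _ (cst (normal_pdf 0 e^-1 x)))
    => [|w _|]; last 2 first.
  - exact: fb.
  - exact: finite_measure_integrable_cst.
  by apply: measurableT_comp mf _; exact: measurable_pair2.
have intf : (P \x mu)%E.-integrable setT (EFin \o f).
  apply/integrable12ltyP; first exact/measurable_EFinP.
  apply: (@le_lt_trans _ _ (\int[P]_w 1)%E); last first.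
    rewrite (integral_cst P measurableT 1%E) mul1e.
    exact: (le_lt_trans (probability_le1 P measurableT) (ltry 1)).
  apply: ge0_le_integral => //.
  - by move=> w _; exact: integral_ge0.
  - apply: (@measurable_fun_fubini_tonelli_F _ _ _ _ _ mu (fun z => `|(f z)%:E|%E)) => //.
    by apply/measurableT_comp => //; exact/measurable_EFinP.
  - move=> w _; rewrite -(integral_normal_pdf 0 e^-1); apply: ge0_le_integral => //.
    + by apply/measurableT_comp => //; exact: measurable_int (intx w).
    + by apply/measurable_EFinP; exact: measurable_normal_pdf.
    + by move=> x _; rewrite lee_fin fb.
have := Fubini intf.
have -> : (\int[P]_w \int[mu]_x (EFin \o f) (w, x) =
    \int[P]_w (normal_fun y e (X w))%:E)%E.
  apply: eq_integral => w _.
  rewrite -[LHS]fineK; last exact: integrable_fin_num (intx w).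
  (* The transform of N(0, e^-2) at X - y is exp(-(X - y)^2 / (2 e^2)), the unnormalized density of
     N(y, e^2). *)
  have := Rintegral_cos_normal_pdf ie0 (X w - y); rewrite /Rintegral /f/= => ->.
  by congr (expR _)%:E; field; rewrite gt_eqF.
have -> : (\int[mu]_x \int[P]_w (EFin \o f) (w, x) =
    \int[mu]_x (normal_peak e^-1 / normal_peak tau^-1 * (cos (y * x) * normal_pdf 0 tau^-1 x))%:E)%E.
  apply: eq_integral => x _.
  rewrite -[LHS]fineK; last exact: integrable_fin_num (intw x).
  congr (_%:E); have := @RintegralZr _ _ _ P setT (fun w => cos ((X w - y) * x))
    (normal_pdf 0 e^-1 x) measurableT.
  rewrite /Rintegral /f/= => ->; last first.
    apply: integrable_le1 => [|w]; last by rewrite ler_norml cos_geN1 cos_le1.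
    by apply: measurable_cos; apply: measurable_funM => //; exact: measurable_funB.
  have := Rintegral_cos_shift x y; rewrite /Rintegral => ->.
  rewrite !normal_pdfE ?gt_eqF//.
  (* The coefficients s^2 and e^2 of - x^2 / 2 add up to tau^2, giving a profile of deviation 1 /
     tau. *)
  have nf : normal_fun 0 tau^-1 x = expR (- (s ^+ 2 * x ^+ 2 / 2)) * normal_fun 0 e^-1 x.
    rewrite /normal_fun -expRD; congr expR; rewrite !subr0 !exprVn tau2.
    by field; rewrite -tau2 !gt_eqF ?exprn_gt0.
  by rewrite nf; field; rewrite gt_eqF// normal_peak_gt0// gt_eqF.
move=> /(congr1 fine) H.
have H1 : \int[P]_w normal_fun y e (X w) = normal_peak e^-1 / normal_peak tau^-1 *
    \int[mu]_x (cos (y * x) * normal_pdf 0 tau^-1 x).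
  rewrite -RintegralZl//.
  apply: (le_integrable_EFin measurableT _ _ (intphi tau^-1)).
    apply: measurable_funM; last exact: measurable_normal_pdf.
    apply: (@measurableT_comp _ _ _ _ _ _ (@cos R)); last exact: measurable_funM.
    by apply: continuous_measurable_fun; exact: continuous_cos.
  move=> x _; rewrite normrM (ger0_norm (normal_pdf_ge0 _ _ _)) ler_piMl ?normal_pdf_ge0//.
  by rewrite ler_norml cos_geN1 cos_le1.
under eq_Rintegral do rewrite normal_pdfE ?gt_eqF//.
rewrite RintegralZl//; last first.
  apply: integrable_le1.
    by apply: measurableT_comp => //; exact: measurable_normal_fun.
  move=> w; rewrite ger0_norm ?normal_fun_ge0// -expR0 ler_expR mulNr oppr_le0.
  by rewrite mulr_ge0 ?sqr_ge0// invr_ge0 mulrn_wge0 ?sqr_ge0.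
rewrite H1 Rintegral_cos_normal_pdf// normal_pdfE ?gt_eqF// mulrA.
(* The product of the peaks for deviations v and 1 / v does not depend on v, so the constants for e
   and for tau match. *)
congr (_ * _).
  rewrite (normal_peakE e0) (normal_peakE ie0) (normal_peakE tau0) (normal_peakE it0) !invrK; field.
  by rewrite !gt_eqF// normal_peak_gt0// oner_neq0.
by rewrite /normal_fun subr0; congr expR; field; rewrite gt_eqF.
Qed.

End smoothed_density.

(** * Removing the smoothing *)

Section characteristic_function_law.
Context {R : realType} d {T : measurableType d} (P : probability T R).
Variables (X : T -> R) (s : R).
Hypothesis mX : measurable_fun setT X.
Hypothesis s0 : 0 < s.
Hypothesis ccos : forall t : R,
  \int[P]_w cos (t * X w) = expR (- (s ^+ 2 * t ^+ 2 / 2)).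
Hypothesis csin : forall t : R, \int[P]_w sin (t * X w) = 0.
Local Notation mu := (@lebesgue_measure R).

(** Brings the variance s^2 + e^2 back to s^2 at a cost that disappears as e tends to 0. The
    exponents differ by x^2 e^2 / (2 s^2 tau^2), bounded on a bounded interval, and the larger
    variance has the smaller peak. *)
Lemma normal_prob_sqrt_le (e c d' : R) : 0 < e ->
  (normal_prob 0 (Num.sqrt (s ^+ 2 + e ^+ 2)) `]c, d'[%classic <=
   (expR (Num.max `|c| `|d'| ^+ 2 * e ^+ 2 / s ^+ 4))%:E *
   normal_prob 0 s `]c, d'[%classic)%E.
Proof.
move=> e0; set tau := Num.sqrt _.
have tau2 : tau ^+ 2 = s ^+ 2 + e ^+ 2 by rewrite sqr_sqrtr ?addr_ge0 ?sqr_ge0.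
have tau0 : 0 < tau by rewrite sqrtr_gt0 addr_gt0 ?exprn_gt0.
set L := Num.max _ _.
have mI : measurable (`]c, d'[%classic : set (measurableTypeR R)) by exact: measurable_itv.
rewrite /normal_prob -ge0_integralZl//; last 2 first.
- by apply/measurable_EFinP/measurable_funTS; exact: measurable_normal_pdf.
- by move=> x _; rewrite lee_fin normal_pdf_ge0.
apply: ge0_le_integral => //.
- by move=> x _; rewrite lee_fin normal_pdf_ge0.
- by apply/measurable_EFinP/measurable_funTS; exact: measurable_normal_pdf.
- by apply/measurable_EFinP/measurable_funM/measurable_funTS => //; exact: measurable_normal_pdf.
move=> x /=; rewrite in_itv/= => /andP[cx xd].
have xL : x ^+ 2 <= L ^+ 2.
  rewrite -(real_normK (num_real x)) lerXn2r ?nnegrE// /L ?le_max ?normr_ge0//.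
  have [x0|x0] := leP 0 x.
    by rewrite (ger0_norm x0); apply/orP; right; rewrite (le_trans (ltW xd)) ?ler_norm.
  rewrite (ltr0_norm x0); apply/orP; left.
  by rewrite -normrN (le_trans _ (ler_norm _))// lerN2 ltW.
rewrite lee_fin !normal_pdfE ?gt_eqF// (normal_peakE s0) (normal_peakE tau0).
have -> : normal_fun 0 tau x = expR (x ^+ 2 * e ^+ 2 / (2 * s ^+ 2 * tau ^+ 2)) * normal_fun 0 s x.
  rewrite /normal_fun -expRD; congr expR; rewrite !subr0 tau2.
  by field; rewrite -tau2 !gt_eqF ?exprn_gt0.
have st : s ^+ 2 <= tau ^+ 2 by rewrite tau2 lerDl sqr_ge0.
have st' : tau^-1 <= s^-1.
  by rewrite lef_pV2 ?posrE// -ler_sqr ?nnegrE ?(ltW s0) ?(ltW tau0).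
have ex : expR (x ^+ 2 * e ^+ 2 / (2 * s ^+ 2 * tau ^+ 2)) <= expR (L ^+ 2 * e ^+ 2 / s ^+ 4).
  rewrite ler_expR ler_pM ?invr_ge0//.
  - by rewrite mulr_ge0 ?sqr_ge0.
  - by rewrite mulr_ge0 ?sqr_ge0// mulr_ge0 ?sqr_ge0.
  - by rewrite ler_wpM2r ?sqr_ge0.
  - rewrite lef_pV2 ?posrE ?mulr_gt0 ?exprn_gt0//.
    have -> : s ^+ 4 = s ^+ 2 * s ^+ 2 by rewrite -exprD.
    have h1 := ler_wpM2l (sqr_ge0 s) st.
    have h2 : 0 <= s ^+ 2 * tau ^+ 2 by rewrite mulr_ge0 ?sqr_ge0.
    by rewrite -[leRHS]mulrA mulr_natl mulr2n (le_trans h1)// lerDl.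
rewrite mulrCA ler_pM ?expR_ge0 ?mulr_ge0 ?invr_ge0 ?normal_peak_ge0 ?normal_fun_ge0 ?(ltW tau0)//.
by rewrite ler_wpM2r ?normal_fun_ge0// ler_wpM2r ?normal_peak_ge0.
Qed.

(** From a point at least r inside the interval, a normal displacement of deviation e stays in the
    interval with probability at least 1 - 6 e^2 / r^2. Averaging over X and exchanging the
    integrals by Tonelli gives the smoothed density. *)
Let smoothed_le (e c d' r : R) : 0 < e -> 0 < r -> 6 * e ^+ 2 <= r ^+ 2 ->
  ((1 - 6 * e ^+ 2 / r ^+ 2)%:E * P (X @^-1` `](c + r)%R, (d' - r)%R[) <=
   normal_prob 0 (Num.sqrt (s ^+ 2 + e ^+ 2)) `]c, d'[%classic)%E.
Proof.
move=> e0 r0 er.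
have mI : measurable (`]c, d'[%classic : set (measurableTypeR R)) by exact: measurable_itv.
have mJ : measurable (X @^-1` `](c + r)%R, (d' - r)%R[).
  by rewrite -[X in measurable X]setTI; apply: mX => //; exact: measurable_itv.
pose f (z : T * measurableTypeR R) : \bar R := (normal_pdf z.2 e (X z.1) * \1_(`]c, d'[%classic) z.2)%:E.
have fE (z : T * measurableTypeR R) :
    f z = (normal_pdf 0 e (X z.1 - z.2) * \1_(`]c, d'[%classic) z.2)%:E.
  by rewrite /f !normal_pdfE ?gt_eqF// /normal_fun subr0.
have mf : measurable_fun setT f.
  rewrite (funext fE); apply/measurable_EFinP/measurable_funM.
    apply: measurableT_comp; first exact: measurable_normal_pdf.
    by apply: measurable_funB => //; exact: measurableT_comp.
  by apply: measurableT_comp => //; exact: measurable_indic.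
have f0 z : (0 <= f z)%E by rewrite lee_fin mulr_ge0 ?normal_pdf_ge0.
have mpdf (w : T) : measurable_fun [set: measurableTypeR R] (fun y => normal_pdf y e (X w)).
  under eq_fun do rewrite normal_pdf_sym ?gt_eqF//.
  exact: measurable_normal_pdf.
have mpdfX (y : R) : measurable_fun setT (fun w => normal_pdf y e (X w)).
  by apply: measurableT_comp => //; exact: measurable_normal_pdf.
have FE w : (\int[mu]_y f (w, y) = normal_prob (X w) e `]c, d'[%classic)%E.
  rewrite /normal_prob [RHS]integral_mkcond.
  apply: eq_integral => y _; rewrite /f /= patchE indicE.
  by case: ifPn => _; rewrite ?mulr1 ?mulr0// normal_pdf_sym ?gt_eqF.
have mF : measurable_fun setT (fun w => normal_prob (X w) e `]c, d'[%classic).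
  rewrite -(funext FE); exact: measurable_fun_fubini_tonelli_F.
have := @fubini_tonelli _ _ _ _ _ P mu f mf f0.
rewrite /fubini_F /fubini_G (funext FE).
have -> : (\int[mu]_y \int[P]_w f (w, y) =
    normal_prob 0 (Num.sqrt (s ^+ 2 + e ^+ 2)) `]c, d'[%classic)%E.
  rewrite /normal_prob [RHS]integral_mkcond; apply: eq_integral => y _.
  rewrite /f /= patchE indicE; case: ifPn => _; last first.
    by under eq_integral do rewrite mulr0; rewrite integral0.
  under eq_integral do rewrite mulr1.
  rewrite -(expectation_normal_pdf mX s0 ccos csin y e0) /Rintegral fineK//.
  apply: integrable_fin_num => //.
  apply: (@le_integrable_EFin _ _ _ _ _ measurableT _ (cst (normal_peak e))) => //.
    by move=> w _; rewrite ger0_norm ?normal_pdf_ge0// normal_pdf_ub ?gt_eqF.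
  exact: finite_measure_integrable_cst.
move=> <-.
rewrite -integral_cst//.
apply: (@le_trans _ _ (\int[P]_(w in X @^-1` `](c + r)%R, (d' - r)%R[)
  normal_prob (X w) e `]c, d'[%classic)%E).
  apply: ge0_le_integral => //.
  - by move=> w _; rewrite lee_fin subr_ge0 ler_pdivrMr ?exprn_gt0// mul1r.
  - exact: measurable_funTS.
  - move=> w /=; rewrite in_itv/= => /andP[cw wd]; apply: normal_prob_oo_ge => //.
      by rewrite lerBrDr ltW.
    by rewrite -lerBrDr ltW.
exact: ge0_subset_integral.
Qed.

Let probability_inner_oo_le (c d' r : R) : 0 < r ->
  (P (X @^-1` `](c + r)%R, (d' - r)%R[) <= normal_prob 0 s `]c, d'[%classic)%E.
Proof.
move=> r0.
have mI : measurable (`]c, d'[%classic : set (measurableTypeR R)) by exact: measurable_itv.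
have mJ : measurable (X @^-1` `](c + r)%R, (d' - r)%R[).
  by rewrite -[X in measurable X]setTI; apply: mX => //; exact: measurable_itv.
set pJ := P _; set nI := normal_prob _ _ _.
have pJfin : pJ \is a fin_num by exact: fin_num_measure.
have nIfin : nI \is a fin_num by exact: fin_num_measure.
rewrite -(fineK pJfin) -(fineK nIfin) lee_fin.
pose C := Num.max `|c| `|d'| ^+ 2 * r ^+ 2 / 9 / s ^+ 4.
have key (n : nat) : (1 - 2 / 3 * (@harmonic R n) ^+ 2) * fine pJ <=
    expR (C * (@harmonic R n) ^+ 2) * fine nI.
  (* With e = (r / 3) u and 0 < u <= 1, 6 e^2 = (2 / 3) u^2 r^2 <= r^2, as [smoothed_le] demands. *)
  pose e := r / 3 * @harmonic R n.
  have h0 : 0 < @harmonic R n by rewrite /harmonic invr_gt0 ltr0n.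
  have h1 : @harmonic R n <= 1 by rewrite /harmonic invf_le1 ?ler1n ?ltr0n.
  have e0 : 0 < e by rewrite mulr_gt0// divr_gt0.
  have hh : @harmonic R n ^+ 2 <= 1 by rewrite expr_le1// ltW.
  have er : 6 * e ^+ 2 <= r ^+ 2.
    have -> : 6 * e ^+ 2 = 2 / 3 * (r ^+ 2 * @harmonic R n ^+ 2) by rewrite /e; field.
    have : r ^+ 2 * @harmonic R n ^+ 2 <= r ^+ 2 by rewrite ler_piMr ?sqr_ge0.
    have : 0 <= r ^+ 2 by exact: sqr_ge0.
    lra.
  have := le_trans (smoothed_le c d' e0 r0 er) (normal_prob_sqrt_le c d' e0).
  rewrite -/pJ -/nI -(fineK pJfin) -(fineK nIfin) -!EFinM lee_fin.
  have -> : 6 * e ^+ 2 / r ^+ 2 = 2 / 3 * @harmonic R n ^+ 2.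
    by rewrite /e; field; rewrite gt_eqF.
  by have -> : Num.max `|c| `|d'| ^+ 2 * e ^+ 2 / s ^+ 4 = C * @harmonic R n ^+ 2
    by rewrite /e /C; field; rewrite gt_eqF.
have ch : (@harmonic R n) ^+ 2 @[n --> \oo] --> 0.
  by rewrite -[X in _ --> X](mulr0 0); apply: cvgM; exact: cvg_harmonic.
have c1 : (1 - 2 / 3 * (@harmonic R n) ^+ 2) * fine pJ @[n --> \oo] -->
    (1 - 2 / 3 * 0) * fine pJ.
  by apply: cvgMl; apply: cvgB; [exact: cvg_cst|exact: cvgMr].
have c2 : expR (C * (@harmonic R n) ^+ 2) * fine nI @[n --> \oo] -->
    expR (C * 0) * fine nI.
  have cC : C * (@harmonic R n) ^+ 2 @[n --> \oo] --> C * 0 by exact: cvgMr.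
  by apply: cvgMl; exact: (cvg_comp _ _ cC (@continuous_expR R (C * 0))).
rewrite mulr0 subr0 mul1r in c1; rewrite mulr0 expR0 mul1r in c2.
rewrite -(cvg_lim _ c1)// -(cvg_lim _ c2)//; apply: ler_lim.
- by apply/cvg_ex; eexists; exact: c1.
- by apply/cvg_ex; eexists; exact: c2.
- exact: nearW.
Qed.

Let probability_oo_le (c d' : R) :
  (P (X @^-1` `]c, d'[%classic) <= normal_prob 0 s `]c, d'[%classic)%E.
Proof.
pose F n : set T := X @^-1` `](c + n.+1%:R^-1)%R, (d' - n.+1%:R^-1)%R[.
have mF n : measurable (F n).
  by rewrite -[X in measurable X]setTI; apply: mX => //; exact: measurable_itv.
have -> : X @^-1` `]c, d'[%classic = \bigcup_n F n.
  apply/seteqP; split => w /=; last first.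
    move=> [n _]; rewrite /F /= !in_itv/= => /andP[h1 h2].
    have n0 : 0 < (n.+1%:R^-1 : R) by rewrite invr_gt0 ltr0n.
    by rewrite (lt_trans _ h1) ?ltrDl// (lt_trans h2)// gtrBl.
  rewrite in_itv/= => /andP[h1 h2].
  have m0 : 0 < Num.min (X w - c) (d' - X w) by rewrite lt_min !subr_gt0 h1 h2.
  have [k] := ltr_add_invr m0; rewrite add0r lt_min => /andP[k1 k2].
  by exists k => //; rewrite /F /= in_itv/= -ltrBrDl k1/= ltrBrDl -ltrBrDr.
have ndF : nondecreasing_seq F.
  move=> m n mn; apply/subsetPset => w; rewrite /F /= !in_itv/= => /andP[h1 h2].
  have le : (n.+1%:R^-1 : R) <= m.+1%:R^-1 by rewrite lef_pV2 ?posrE ?ltr0n// ler_nat ltnS.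
  by rewrite (le_lt_trans _ h1) ?lerD2l// (lt_le_trans h2)// lerD2l lerN2.
have cv : (P (F n) @[n --> \oo] --> P (\bigcup_n F n))%E.
  by apply: nondecreasing_cvg_mu => //; exact: bigcup_measurable.
rewrite -(cvg_lim _ cv)//; apply: lime_le; first by apply/cvg_ex; eexists; exact: cv.
by apply: nearW => n; apply: probability_inner_oo_le; rewrite invr_gt0 ltr0n.
Qed.

Lemma pushforward_normal_prob (A : set (measurableTypeR R)) :
  measurable A -> pushforward P X A = normal_prob 0 s A.
Proof.
move=> mA.
have mX' : @measurable_fun _ _ T (measurableTypeR R) setT X by exact: mX.
pose Xm : {mfun T >-> measurableTypeR R} :=
  @mfun_Sub _ _ T (measurableTypeR R) X (mem_set mX').
have := @probability_eq_of_le_oo R (distribution P Xm) (normal_prob 0 s) _ A mA.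
by apply=> c d' _; exact: probability_oo_le.
Qed.

End characteristic_function_law.

(** * Hermite functions and Mehler's formula *)

Section hermite_recurrence.
Context {R : realType}.
Local Notation D n := (derive1n n (fun y : R => expR (- y ^+ 2))).

Let is_derive_expNsqr (x : R) :
  is_derive x (1 : R) (fun y : R => expR (- y ^+ 2)) (- 2 * x * expR (- x ^+ 2)).
Proof.
have h : is_derive x (1 : R) (fun y : R => - y ^+ 2) (- (2 * x)).
  by apply: is_derive_eq; rewrite /GRing.scale /=; ring.
have h' := is_derive1_comp (is_derive_expR _) h.
by apply: is_derive_eq; ring.
Qed.

(** Differentiability and recurrence go through one induction: the recurrence expresses F_{n+2} by
    two functions already known to be differentiable, and its derivative is the recurrence at the
    next index. *)
Let derive_seq_spec (F : nat -> R -> R) :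
  F 0%N = (fun y => expR (- y ^+ 2)) -> (forall n, F n.+1 = derive1 (F n)) ->
  F 1%N = (fun x => - 2 * x * expR (- x ^+ 2)) /\
  forall n, (forall x : R, is_derive x (1 : R) (F n) (F n.+1 x)) /\
  (forall x : R, is_derive x (1 : R) (F n.+1) (F n.+2 x)) /\
  forall x, F n.+2 x = - 2 * x * F n.+1 x - 2 * n.+1%:R * F n x.
Proof.
move=> F0 FS.
have F1 : F 1%N = (fun x => - 2 * x * expR (- x ^+ 2)).
  by apply/funext => x; rewrite FS F0 derive1E; have [_ ->] := is_derive_expNsqr x.
split=> // n.
have dS m x (df : R) : is_derive x (1 : R) (F m) df -> F m.+1 x = df.
  by move=> h; rewrite FS derive1E (derive_val (is_derive := h)).
elim: n => [|n [dn [dn1 rec]]].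
  have d0 x : is_derive x (1 : R) (F 0%N) (- 2 * x * expR (- x ^+ 2)).
    by rewrite F0; exact: is_derive_expNsqr.
  have d1 (x : R) : is_derive x (1 : R) (F 1%N) (- 2 * x * F 1%N x - 2 * 1%:R * F 0%N x).
    rewrite F1 F0; have h := is_derive_expNsqr x.
    by apply: is_derive_eq; rewrite /GRing.scale /=; ring.
  split; first by move=> x; rewrite (dS _ _ _ (d0 x)); exact: d0.
  split; first by move=> x; rewrite (dS _ _ _ (d1 x)); exact: d1.
  by move=> x; rewrite (dS _ _ _ (d1 x)).
have E : F n.+2 = (fun x => - 2 * x * F n.+1 x - 2 * n.+1%:R * F n x).
  by apply/funext => x; exact: rec.
have d2 (x : R) : is_derive x (1 : R) (F n.+2) (- 2 * x * F n.+2 x - 2 * n.+2%:R * F n.+1 x).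
  have h1 := dn x; have h2 := dn1 x.
  rewrite [in is_derive _ _ (F n.+2)]E.
  apply: is_derive_eq; rewrite /GRing.scale /= -(natr1 n.+1); ring.
split; first exact: dn1.
split; first by move=> x; rewrite (dS _ _ _ (d2 x)); exact: d2.
by move=> x; rewrite (dS _ _ _ (d2 x)).
Qed.

Let derive1_expNsqr : D 1 = (fun x => - 2 * x * expR (- x ^+ 2)).
Proof.
by have [] := @derive_seq_spec (fun n => D n) erefl (fun n => derive1nS _ n).
Qed.

Let derive1n_spec n : (forall x : R, is_derive x (1 : R) (D n) (D n.+1 x)) /\
  forall x, D n.+2 x = - 2 * x * D n.+1 x - 2 * n.+1%:R * D n x.
Proof.
have [_ /(_ n)[h1 [_ h2]]] := @derive_seq_spec (fun n => D n) erefl (fun n => derive1nS _ n).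
by split; [exact: h1|exact: h2].
Qed.

(* H_n(x) exp(-x^2/2) for the physicists' Hermite polynomial H_n; the Hermite
   function is herm n / sqrt (herm_weight n). *)
Definition herm (n : nat) (x : R) : R := (-1) ^+ n * expR (x ^+ 2 / 2) * D n x.

Definition herm_weight (n : nat) : R := Num.sqrt pi * 2 ^+ n * n`!%:R.

Lemma herm_weight_gt0 n : 0 < herm_weight n.
Proof. by rewrite !mulr_gt0 ?sqrtr_gt0 ?pi_gt0 ?exprn_gt0 ?ltr0n ?fact_gt0. Qed.

Lemma herm_weightS n : herm_weight n.+1 = 2 * n.+1%:R * herm_weight n.
Proof. by rewrite /herm_weight exprS factS natrM; ring. Qed.

Lemma herm0 x : herm 0 x = expR (- (x ^+ 2 / 2)).
Proof. by rewrite /herm /= mul1r -expRD; congr expR; field. Qed.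

Lemma herm1 x : herm 1 x = 2 * x * herm 0 x.
Proof. by rewrite /herm derive1_expNsqr /=; ring. Qed.

Lemma hermSS n x : herm n.+2 x = 2 * x * herm n.+1 x - 2 * n.+1%:R * herm n x.
Proof.
by rewrite /herm; have [_ ->] := derive1n_spec n; rewrite !exprS; ring.
Qed.

Lemma continuous_herm n : continuous (herm n).
Proof.
move=> x; have [/(_ x) h _] := derive1n_spec n.
have cD : {for x, continuous (D n)}.
  by apply: differentiable_continuous; apply/derivable1_diffP; have [] := h.
have ce : x ^+ 2 / 2 @[x --> x] --> x ^+ 2 / 2.
  by apply: cvgMl; exact: sqr_continuous.
apply: cvgM => //; apply: cvgMr.
exact: (cvg_comp _ _ ce (@continuous_expR R (x ^+ 2 / 2))).
Qed.

(** In a product of two values the fractional powers of 2 and of the factorial combine, leaving a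
    weight whose successive ratios are the integers 2 (n + 1). *)
Lemma hermite_functionM n x y :
  hermite_function n x * hermite_function n y = herm n x * herm n y / herm_weight n.
Proof.
rewrite /hermite_function -/(D n) /herm.
set N := pi `^ (1 / 4) * 2 `^ (n%:R / 2) * n`!%:R `^ (1 / 2).
have N2 : N * N = herm_weight n.
  have sq (a b : R) : a `^ b * a `^ b = a `^ (b + b).
    have [b0|b0] := eqVneq b 0; first by rewrite b0 addr0 !powRr0 mulr1.
    by rewrite -powRD//; apply/implyP => /eqP bb; case/eqP: b0; lra.
  have -> : N * N = (pi `^ (1 / 4) * pi `^ (1 / 4)) * (2 `^ (n%:R / 2) * 2 `^ (n%:R / 2)) *
     (n`!%:R `^ (1 / 2) * n`!%:R `^ (1 / 2)) by rewrite /N; ring.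
  rewrite !sq -splitr powR_mulrn// -splitr powRr1//.
  have -> : 1 / 4 + 1 / 4 = 2^-1 :> R by field.
  by rewrite powR12_sqrt// pi_ge0.
have N0 : N != 0.
  by apply/eqP => N0; have := herm_weight_gt0 n; rewrite -N2 N0 mulr0 ltxx.
rewrite -N2.
have s2 : (-1) ^+ n * (-1) ^+ n = 1 :> R by rewrite -expr2 sqrr_sign.
by field.
Qed.

Lemma hermite_functionE n x :
  hermite_function n x = herm n x / (pi `^ (1 / 4) * 2 `^ (n%:R / 2) * n`!%:R `^ (1 / 2)).
Proof. by rewrite /hermite_function /herm; ring. Qed.

Lemma continuous_hermite_function n : continuous (@hermite_function R n).
Proof.
rewrite (funext (hermite_functionE n)) => x; apply: cvgMl; exact: continuous_herm.
Qed.

Let normsq n (x : R) := herm n x ^+ 2 / herm_weight n.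

(** Young's inequality with parameter [del] splits the cross term of the three-term recurrence.
    After division by the weights, z_n^2 gets a multiplier at most 1 + del, while that of z_{n+1}^2
    exceeds 1 only by O(1 / n). *)
Let normsq_rec (L del : R) n x : 0 <= L -> `|x| <= L -> 0 < del ->
  normsq n.+2 x + normsq n.+1 x <=
  (1 + Num.max del ((1 + del^-1) * 2 * L ^+ 2 / n.+2%:R)) * (normsq n.+1 x + normsq n x).
Proof.
move=> L0 xL d0; rewrite /normsq !herm_weightS hermSS.
have w0 := herm_weight_gt0 n; move: w0.
set w := herm_weight n; set p := herm n.+1 x; set q := herm n x => w0.
have m0 : 0 < (n.+1%:R : R) by rewrite ltr0n.
have m1 : (n.+2%:R : R) = n.+1%:R + 1 by rewrite -natr1.
rewrite m1; move: m0; set m := (n.+1%:R : R) => m0.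
have m10 : 0 < m + 1 by rewrite addr_gt0.
set E := Num.max _ _.
have E1 : del <= E by rewrite le_max lexx.
have E2 : (1 + del^-1) * 2 * L ^+ 2 / (m + 1) <= E by rewrite le_max lexx orbT.
have x2 : x ^+ 2 <= L ^+ 2 by rewrite -(real_normK (num_real x)) lerXn2r ?nnegrE.
have young : (x * p - m * q) ^+ 2 <= (1 + del) * (m ^+ 2 * q ^+ 2) + (1 + del^-1) * (L ^+ 2 * p ^+ 2).
  (* This square is exactly the difference of the two sides of Young's inequality, before x^2 is
     replaced by L^2. *)
  have : 0 <= del^-1 * (x * p + del * m * q) ^+ 2 by rewrite mulr_ge0 ?sqr_ge0 ?invr_ge0 ?ltW.
  have -> : del^-1 * (x * p + del * m * q) ^+ 2 =
     del^-1 * (x ^+ 2 * p ^+ 2) + 2 * x * p * m * q + del * (m ^+ 2 * q ^+ 2).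
    by field; rewrite gt_eqF.
  move=> h.
  have h2 : (1 + del^-1) * (x ^+ 2 * p ^+ 2) <= (1 + del^-1) * (L ^+ 2 * p ^+ 2).
    rewrite ler_wpM2l//; first by rewrite addr_ge0// invr_ge0 ltW.
    by rewrite ler_wpM2r ?sqr_ge0.
  have -> : (x * p - m * q) ^+ 2 = x ^+ 2 * p ^+ 2 - 2 * x * p * m * q + m ^+ 2 * q ^+ 2 by ring.
  rewrite !mulrDl !mul1r in h2 *; lra.
have -> : (2 * x * p - 2 * m * q) ^+ 2 / (2 * (m + 1) * (2 * m * w)) + p ^+ 2 / (2 * m * w)
   = ((x * p - m * q) ^+ 2 / (m * (m + 1)) + p ^+ 2 / (2 * m)) / w.
  by field; rewrite !gt_eqF.
have -> : (1 + E) * (p ^+ 2 / (2 * m * w) + q ^+ 2 / w) =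
   ((1 + E) * (p ^+ 2 / (2 * m) + q ^+ 2)) / w by field; rewrite !gt_eqF.
rewrite ler_pM2r ?invr_gt0//.
apply: (@le_trans _ _ (((1 + del) * (m ^+ 2 * q ^+ 2) +
    (1 + del^-1) * (L ^+ 2 * p ^+ 2)) / (m * (m + 1)) + p ^+ 2 / (2 * m))).
  by rewrite lerD2r ler_wpM2r// invr_ge0 mulr_ge0// ltW.
have -> : ((1 + del) * (m ^+ 2 * q ^+ 2) +
    (1 + del^-1) * (L ^+ 2 * p ^+ 2)) / (m * (m + 1)) + p ^+ 2 / (2 * m)
  = (1 + del) * q ^+ 2 * (m / (m + 1)) + (1 + (1 + del^-1) * 2 * L ^+ 2 / (m + 1)) * (p ^+ 2 / (2 * m)).
  by field; rewrite !gt_eqF.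
rewrite [leRHS]mulrDr [leLHS]addrC lerD//.
  by rewrite ler_wpM2r ?lerD2l// mulr_ge0 ?sqr_ge0// invr_ge0 mulr_ge0// ltW.
apply: (@le_trans _ _ ((1 + del) * q ^+ 2)).
  apply: ler_piMr; last by rewrite ler_pdivrMr// mul1r lerDl.
  by rewrite mulr_ge0 ?sqr_ge0// addr_ge0// ltW.
by rewrite ler_wpM2r ?sqr_ge0// lerD2l.
Qed.

Let normsq_ge0 n x : 0 <= normsq n x.
Proof. by rewrite mulr_ge0 ?sqr_ge0// invr_ge0 ltW// herm_weight_gt0. Qed.

(* The energy z_{n+1}^2 + z_n^2 of the normalized functions is multiplied at each
   step by a factor that is eventually below rho. *)
Lemma herm_growth (L rho : R) : 1 < rho ->
  exists2 K, 0 <= K & forall n x, `|x| <= L -> herm n x ^+ 2 / herm_weight n <= K * rho ^+ n.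
Proof.
move=> rho1; have [L0|L0] := ltP L 0.
  by exists 0 => // n x /(le_lt_trans)/(_ L0); rewrite normr_lt0.
pose del := rho - 1; have d0 : 0 < del by rewrite subr_gt0.
pose B := (1 + del^-1) * 2 * L ^+ 2.
have B0 : 0 <= B by rewrite !mulr_ge0 ?sqr_ge0// addr_ge0// invr_ge0 ltW.
(* From [n0] on, B / (n + 2) <= del, so each step multiplies the energy by at most 1 + del = rho;
   the finitely many earlier steps cost at most M = rho + B each. V bounds the initial energy. *)
pose n0 := Num.truncn (del^-1 * B).
pose M := rho + B.
have M1 : 1 <= M by rewrite /M; lra.
have M0 : 0 <= M by rewrite (le_trans _ M1).
have Mr : rho <= M by rewrite /M lerDl.
pose V := (1 + 2 * L ^+ 2) / herm_weight 0.
have V0 : 0 <= V.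
  by rewrite divr_ge0 ?(ltW (herm_weight_gt0 _))// addr_ge0// mulr_ge0 ?sqr_ge0.
have step n x : `|x| <= L -> normsq n.+2 x + normsq n.+1 x <=
    M * (normsq n.+1 x + normsq n x).
  move=> xL; apply: (le_trans (normsq_rec n L0 xL d0)).
  rewrite ler_wpM2r ?addr_ge0// /M; have -> : rho = 1 + del by rewrite /del; ring.
  rewrite -addrA lerD2l ge_max lerDl B0/=.
  rewrite (@le_trans _ _ B)// ?lerDr ?(ltW d0)//.
  by rewrite ler_piMr// invf_le1 ?ltr0n// ler1n.
have step' n x : `|x| <= L -> (n0 <= n)%N -> normsq n.+2 x + normsq n.+1 x <=
    rho * (normsq n.+1 x + normsq n x).
  move=> xL n0n; apply: (le_trans (normsq_rec n L0 xL d0)).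
  rewrite ler_wpM2r ?addr_ge0//; have -> : rho = 1 + del by rewrite /del; ring.
  rewrite lerD2l ge_max lexx/= ler_pdivrMr ?ltr0n// -ler_pdivrMl//.
  apply: (@le_trans _ _ n0.+1%:R); first exact: ltW (truncnS_gt _).
  by rewrite ler_nat ltnS (leq_trans n0n).
have base x : `|x| <= L -> normsq 1 x + normsq 0 x <= V.
  move=> xL; rewrite /normsq herm_weightS herm1 mulr1.
  have -> : (2 * x * herm 0 x) ^+ 2 / (2 * herm_weight 0) + herm 0 x ^+ 2 / herm_weight 0
    = (1 + 2 * x ^+ 2) * herm 0 x ^+ 2 / herm_weight 0.
    by field; rewrite gt_eqF// herm_weight_gt0.
  rewrite /V ler_wpM2r ?invr_ge0 ?(ltW (herm_weight_gt0 _))//.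
  have x2 : x ^+ 2 <= L ^+ 2 by rewrite -(real_normK (num_real x)) lerXn2r ?nnegrE.
  apply: (@le_trans _ _ (1 + 2 * x ^+ 2)); last lra.
  apply: ler_piMr; first by rewrite addr_ge0// mulr_ge0 ?sqr_ge0.
  rewrite exprn_ile1 ?herm0 ?expR_ge0// -expR0 ler_expR oppr_le0.
  by rewrite divr_ge0 ?sqr_ge0.
have all n x : `|x| <= L -> normsq n.+1 x + normsq n x <= V * M ^+ n0 * rho ^+ n.
  move=> xL; have small m : (m <= n0)%N -> normsq m.+1 x + normsq m x <= V * M ^+ m.
    elim: m => [_|m ih mn]; first by rewrite expr0 mulr1; exact: base.
    rewrite (le_trans (step _ _ xL))// exprS mulrCA ler_wpM2l//.
    by apply: ih; exact: ltnW.
  elim: n => [|n ih].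
    rewrite expr0 mulr1 (le_trans (base _ xL))// ler_peMr//.
    exact: exprn_ege1.
  have [nn0|nn0] := leqP n0 n.
    by rewrite (le_trans (step' _ _ xL nn0))// exprS mulrCA ler_wpM2l//; lra.
  rewrite (le_trans (small _ nn0))// -mulrA ler_wpM2l//.
  rewrite (le_trans (ler_weXn2l M1 nn0))// ler_peMr ?exprn_ge0//.
  by rewrite exprn_ege1// ltW.
exists (V * M ^+ n0); first by rewrite mulr_ge0// exprn_ge0.
by move=> n x xL; rewrite (le_trans _ (all n x xL))// lerDr.
Qed.

End hermite_recurrence.

(** * Power series with subexponential coefficients *)

Section power_series.
Context {R : realType}.
Implicit Types (a b : nat -> R) (r : R).

(** A radius of convergence at least 1, put in a form that is visibly stable under shifts, linear
    combinations and multiplication by n. *)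
Definition subexponential a :=
  forall rho : R, 1 < rho -> exists K, forall n, `|a n| <= K * rho ^+ n.

Definition pser a r : R := limn (pseries a r).

Lemma subexponential_ge0 a rho : subexponential a -> 1 < rho ->
  exists2 K, 0 <= K & forall n, `|a n| <= K * rho ^+ n.
Proof.
move=> /[apply] -[K aK]; exists K => //.
by have := aK 0%N; rewrite expr0 mulr1; apply: le_trans.
Qed.

Lemma subexponentialS a : subexponential a -> subexponential (fun n => a n.+1).
Proof.
move=> sa rho rho1; have [K aK] := sa _ rho1; exists (K * rho) => n.
by rewrite -mulrA -exprS.
Qed.

Lemma subexponentialD a b : subexponential a -> subexponential b ->
  subexponential (fun n => a n + b n).
Proof.
move=> sa sb rho rho1; have [K aK] := sa _ rho1; have [K' bK] := sb _ rho1.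
by exists (K + K') => n; rewrite (le_trans (ler_normD _ _))// mulrDl lerD.
Qed.

Lemma subexponentialZ k a : subexponential a -> subexponential (fun n => k * a n).
Proof.
move=> sa rho rho1; have [K aK] := sa _ rho1.
by exists (`|k| * K) => n; rewrite normrM -mulrA ler_wpM2l.
Qed.

(** Half of the rate rho pays for the factor n: with rho = t^2, Bernoulli's inequality gives n (t -
    1) <= t^n, and t is left as a rate for a. *)
Lemma subexponential_natM a : subexponential a -> subexponential (fun n => n%:R * a n).
Proof.
move=> sa rho rho1; have srho : 1 < Num.sqrt rho by rewrite -[ltLHS]sqrtr1 ltr_sqrt// (lt_trans _ rho1).
have [K K0 aK] := subexponential_ge0 sa srho.
have d0 : 0 < Num.sqrt rho - 1 by rewrite subr_gt0.
exists ((Num.sqrt rho - 1)^-1 * K) => n.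
have -> : rho ^+ n = Num.sqrt rho ^+ n * Num.sqrt rho ^+ n.
  by rewrite -exprMn -expr2 sqr_sqrtr// ltW// (lt_trans _ rho1).
rewrite normrM ger0_norm//.
have bern : n%:R * (Num.sqrt rho - 1) <= Num.sqrt rho ^+ n.
  elim: n => [|n ih]; first by rewrite mul0r.
  rewrite exprS -natr1 mulrDl mul1r.
  have s1 : 1 <= Num.sqrt rho ^+ n by rewrite exprn_ege1// ltW.
  have : (Num.sqrt rho - 1) * 1 <= (Num.sqrt rho - 1) * Num.sqrt rho ^+ n by rewrite ler_wpM2l// ltW.
  rewrite mulrBl mul1r mulr1; lra.
rewrite (_ : _ * K * _ =
  (Num.sqrt rho ^+ n / (Num.sqrt rho - 1)) * (K * Num.sqrt rho ^+ n)); last by ring.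
by rewrite ler_pM// ler_pdivlMr.
Qed.

Lemma subexponential_diffs a : subexponential a -> subexponential (pseries_diffs a).
Proof. by move=> sa; exact: (subexponentialS (subexponential_natM sa)). Qed.

Lemma le_subexponential a b : subexponential b -> (forall n, `|a n| <= b n) -> subexponential a.
Proof.
move=> sb ab rho rho1; have [K bK] := sb _ rho1; exists K => n.
by rewrite (le_trans (ab n))// (le_trans (ler_norm _)).
Qed.

Lemma subexponential_cvg a r : subexponential a -> `|r| < 1 -> cvgn (pseries a r).
Proof.
move=> sa r1; have p0 : 0 < 1 + `|r| by rewrite ltr_pwDl.
(* The rate 2 / (1 + |r|) exceeds 1, yet its product with |r| is still below 1. *)
have [K K0 aK] : exists2 K, 0 <= K & forall n, `|a n| <= K * (2 / (1 + `|r|)) ^+ n.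
  by apply: subexponential_ge0 => //; rewrite ltr_pdivlMr// mul1r; lra.
apply: normed_cvg; apply: (@series_le_cvg _ _ (fun n => K * (2 / (1 + `|r|) * `|r|) ^+ n)).
- by move=> n; rewrite normr_ge0.
- by move=> n; rewrite mulr_ge0// exprn_ge0// mulr_ge0// divr_ge0// ltW.
- by move=> n /=; rewrite normrM normrX exprMn mulrA ler_wpM2r// exprn_ge0.
- apply: is_cvg_geometric_series; rewrite ger0_norm.
    by rewrite mulrAC ltr_pdivrMr// mul1r; lra.
  by rewrite mulr_ge0// divr_ge0// ltW.
Qed.

Lemma pserD a b k l r : subexponential a -> subexponential b -> `|r| < 1 ->
  pser (fun n => k * a n + l * b n) r = k * pser a r + l * pser b r.
Proof.
move=> sa sb r1; apply/cvg_lim => //.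
have ca : k * pseries a r n @[n --> \oo] --> k * pser a r.
  by apply: cvgMr; exact: subexponential_cvg.
have cb : l * pseries b r n @[n --> \oo] --> l * pser b r.
  by apply: cvgMr; exact: subexponential_cvg.
rewrite (_ : pseries _ r = (fun n => k * pseries a r n + l * pseries b r n)).
  exact: cvgD.
apply/funext => n; rewrite /pseries /series /= !mulr_sumr -big_split/=.
by apply: eq_bigr => i _; ring.
Qed.

Lemma pserS a r : subexponential a -> `|r| < 1 ->
  pser a r = a 0%N + r * pser (fun n => a n.+1) r.
Proof.
move=> sa r1; apply/cvg_lim => //; rewrite -cvg_shiftS.
rewrite (_ : (fun n => _) = (fun n => a 0%N + r * pseries (fun n => a n.+1) r n)).
  apply: cvgD; first exact: cvg_cst.
  by apply: cvgMr; apply: subexponential_cvg => //; exact: subexponentialS.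
apply/funext => n; rewrite /pseries /series /= big_nat_recl//= expr0 mulr1.
by congr (_ + _); rewrite mulr_sumr; apply: eq_bigr => i _; rewrite exprS; ring.
Qed.

Lemma is_derive_pser a r : subexponential a -> `|r| < 1 ->
  is_derive r (1 : R) (pser a) (pser (pseries_diffs a) r).
Proof.
move=> sa r1.
(* The midpoint (1 + |r|) / 2 is a radius strictly between |r| and 1. *)
have k0 : 0 <= (1 + `|r|) / 2 by rewrite divr_ge0// addr_ge0.
have k1 : `|(1 + `|r|) / 2| < 1 by rewrite ger0_norm//; lra.
apply: (@pseries_snd_diffs _ a ((1 + `|r|) / 2)).
- exact: subexponential_cvg.
- by apply: subexponential_cvg => //; exact: subexponential_diffs.
- by apply: subexponential_cvg => //; do 2! apply: subexponential_diffs.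
- by rewrite (ger0_norm k0); lra.
Qed.

Lemma pser0 a : pser a 0 = a 0%N.
Proof.
apply/cvg_lim => //; rewrite -cvg_shiftS; apply: cvg_near_cst; apply: nearW => n.
rewrite /pseries /series /= big_nat_recl//= expr0 mulr1 big1 ?addr0// => i _.
by rewrite exprS mul0r mulr0.
Qed.

End power_series.

(** * Mehler's formula *)

Section mehler.
Context {R : realType}.
Variables x y : R.
Local Notation w := (@herm_weight R).

(* The three-term recurrence expresses the generating series of B and C, and the
   derivative of that of a, through each other; eliminating B and C leaves a
   first-order linear differential equation in r for the series of a. *)
Let a n := herm n x * herm n y / w n.
Let B n := herm n.+1 x * herm n y / w n.
Let C n := herm n x * herm n.+1 y / w n.

Let w0 n : w n != 0. Proof. by rewrite gt_eqF// herm_weight_gt0. Qed.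

Let n1 (n : nat) : 1 + n%:R != 0 :> R. Proof. by rewrite nat1r pnatr_eq0. Qed.

Let subexp_sq (z : R) : subexponential (fun n => herm n z ^+ 2 / w n).
Proof.
move=> rho rho1; have [K _ hK] := @herm_growth R `|z| rho rho1.
exists K => n; rewrite ger0_norm ?hK//.
by rewrite divr_ge0 ?sqr_ge0// ltW// herm_weight_gt0.
Qed.

(** The shifted index against the old weight is, up to the factor 2, the coefficient sequence of a
    differentiated series. *)
Let subexp_sqS (z : R) : subexponential (fun n => herm n.+1 z ^+ 2 / w n).
Proof.
rewrite (_ : (fun n => _) = (fun n => 2 * pseries_diffs (fun n => herm n z ^+ 2 / w n) n)).
  by apply: subexponentialZ; exact: subexponential_diffs.
by apply/funext => n; rewrite /pseries_diffs herm_weightS; field; rewrite ?w0 ?n1.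
Qed.

Let amgm (u v z : R) : 0 < z -> `|u * v / z| <= 2^-1 * (u ^+ 2 / z) + 2^-1 * (v ^+ 2 / z).
Proof.
move=> z0; rewrite -mulrDr -mulrDl mulrA normrM (gtr0_norm (x := z^-1)) ?invr_gt0//.
rewrite ler_pM2r ?invr_gt0// normrM -(real_normK (num_real u)) -(real_normK (num_real v)).
have : 0 <= (`|u| - `|v|) ^+ 2 by exact: sqr_ge0.
by move=> h; nra.
Qed.

Let subexp_prod (i j : nat -> R) :
  subexponential (fun n => i n ^+ 2 / w n) -> subexponential (fun n => j n ^+ 2 / w n) ->
  subexponential (fun n => i n * j n / w n).
Proof.
move=> si sj.
apply: (@le_subexponential _ _ (fun n => 2^-1 * (i n ^+ 2 / w n) + 2^-1 * (j n ^+ 2 / w n))).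
  by apply: subexponentialD; exact: subexponentialZ.
by move=> n; apply: amgm; exact: herm_weight_gt0.
Qed.

Let sa : subexponential a.
Proof. by apply: subexp_prod; exact: subexp_sq. Qed.

Let sB : subexponential B.
Proof.
by apply: (@subexp_prod (fun n => herm n.+1 x)); [exact: subexp_sqS|exact: subexp_sq].
Qed.

Let sC : subexponential C.
Proof.
by apply: (@subexp_prod _ (fun n => herm n.+1 y)); [exact: subexp_sq|exact: subexp_sqS].
Qed.

Let BE r : `|r| < 1 -> pser B r = 2 * x * pser a r - r * pser C r.
Proof.
move=> r1; rewrite (pserS sB r1).
rewrite (_ : (fun n => B n.+1) = (fun n => (2 * x) * a n.+1 + (-1) * C n)); last first.
  apply/funext => n; rewrite /B /a /C hermSS herm_weightS.
  by field; rewrite ?w0 ?n1.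
rewrite (pserD _ _ (subexponentialS sa) sC r1) (pserS sa r1).
by rewrite /B /a herm1; field.
Qed.

Let CE r : `|r| < 1 -> pser C r = 2 * y * pser a r - r * pser B r.
Proof.
move=> r1; rewrite (pserS sC r1).
rewrite (_ : (fun n => C n.+1) = (fun n => (2 * y) * a n.+1 + (-1) * B n)); last first.
  apply/funext => n; rewrite /B /a /C hermSS herm_weightS.
  by field; rewrite ?w0 ?n1.
rewrite (pserD _ _ (subexponentialS sa) sB r1) (pserS sa r1).
by rewrite /C /a herm1; field.
Qed.

Let DE r : `|r| < 1 -> 2 * pser (pseries_diffs a) r =
  2 * x * pser C r - 2 * y * r * pser C r + 2 * r * (pser a r + r * pser (pseries_diffs a) r).
Proof.
move=> r1; have sd := subexponential_diffs sa.
have sn := subexponential_natM sa.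
have E : pser (fun n => n%:R * a n) r = r * pser (pseries_diffs a) r.
  by rewrite (pserS sn r1) mul0r add0r.
rewrite [X in 2 * X = _](pserS sd r1).
(* Applying the recurrence to the factor in x and then to the factor in y turns (n + 2) a_{n+2} into
   x C_{n+1} - y C_n + (n + 1) a_n. *)
rewrite (_ : (fun n => pseries_diffs a n.+1) =
    (fun n => x * C n.+1 + 1 * ((- y) * C n + 1 * (1 * a n + 1 * (n%:R * a n))))); last first.
  apply/funext => n; rewrite /pseries_diffs /a /C !hermSS.
  by rewrite !herm_weightS -!natr1; field; rewrite w0 !natr1 !pnatr_eq0.
have s1 : subexponential (fun n => 1 * a n + 1 * (n%:R * a n)).
  by apply: subexponentialD; exact: subexponentialZ.
have s2 : subexponential (fun n => - y * C n + 1 * (1 * a n + 1 * (n%:R * a n))).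
  by apply: subexponentialD; exact: subexponentialZ.
rewrite (pserD _ _ (subexponentialS sC) s2 r1) (pserD _ _ sC s1 r1) (pserD _ _ sa sn r1) E.
rewrite [in 2 * x * pser C r](pserS sC r1) /pseries_diffs /a /C herm1 herm_weightS.
by field; rewrite w0.
Qed.

Let ode r : `|r| < 1 -> pser (pseries_diffs a) r =
  ((x - r * y) * (2 * y - 2 * r * x) / (1 - r ^+ 2) + r) / (1 - r ^+ 2) * pser a r.
Proof.
move=> r1; have r2 : 1 - r ^+ 2 != 0.
  by rewrite gt_eqF// subr_gt0 -(real_normK (num_real r)) exprn_ilt1.
have hC : pser C r = (2 * y - 2 * r * x) / (1 - r ^+ 2) * pser a r.
  have h := CE r1; rewrite (BE r1) in h.
  have h' : (1 - r ^+ 2) * pser C r = (2 * y - 2 * r * x) * pser a r.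
    by rewrite mulrBl mul1r {1}h; ring.
  by apply: (mulfI r2); rewrite h'; field.
have := DE r1; rewrite hC => h; apply: (mulfI r2).
have -> : (1 - r ^+ 2) * pser (pseries_diffs a) r =
  (x - r * y) * ((2 * y - 2 * r * x) / (1 - r ^+ 2) * pser a r) + r * pser a r by lra.
by field.
Qed.

(** The primitive, vanishing at r = 0, of the coefficient in the differential equation; exp(phi) is
    the classical Mehler kernel for Hermite polynomials. *)
Let phi (r : R) : R :=
  (2 * x * y * r - r ^+ 2 * (x ^+ 2 + y ^+ 2)) / (1 - r ^+ 2) - ln (1 - r ^+ 2) / 2.

Let one_sub_sqr_gt0 (r : R) : `|r| < 1 -> 0 < 1 - r ^+ 2.
Proof. by move=> r1; rewrite subr_gt0 -(real_normK (num_real r)) exprn_ilt1. Qed.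

Let is_derive_phi (r : R) : `|r| < 1 -> is_derive r (1 : R) phi
  (((x - r * y) * (2 * y - 2 * r * x) / (1 - r ^+ 2) + r) / (1 - r ^+ 2)).
Proof.
move=> r1; have u0 := one_sub_sqr_gt0 r1; have un0 := lt0r_neq0 u0.
have du : is_derive r (1 : R) (fun r : R => 1 - r ^+ 2) (- 2 * r).
  by apply: is_derive_eq; rewrite /GRing.scale /=; ring.
have dl := @is_derive1_comp R (@ln R) (fun r => 1 - r ^+ 2) r _ _ (is_derive1_ln u0) du.
have di : is_derive r (1 : R) (fun r : R => (1 - r ^+ 2)^-1) (2 * r / (1 - r ^+ 2) ^+ 2).
  by apply: is_derive_eq; rewrite /GRing.scale /=; field.
have dn : is_derive r (1 : R) (fun r : R => 2 * x * y * r - r ^+ 2 * (x ^+ 2 + y ^+ 2))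
    (2 * x * y - 2 * r * (x ^+ 2 + y ^+ 2)).
  by apply: is_derive_eq; rewrite /GRing.scale /=; ring.
have -> : phi = (fun r => (fun r : R => 2 * x * y * r - r ^+ 2 * (x ^+ 2 + y ^+ 2)) r *
   (fun r : R => (1 - r ^+ 2)^-1) r - (@ln R \o (fun r : R => 1 - r ^+ 2)) r / 2) by [].
by apply: is_derive_eq; rewrite /GRing.scale /=; field.
Qed.

Let pser_expR (r : R) : 0 <= r -> r < 1 -> pser a r = a 0%N * expR (phi r).
Proof.
move=> r0 r1.
pose h (t : R) := pser a t * expR (- phi t).
have dh (t : R) : `|t| < 1 -> is_derive t (1 : R) h 0.
  move=> t1; have d1 := is_derive_pser sa t1; have d2 := is_derive_phi t1.
  have d3 : is_derive t (1 : R) (fun t => - phi t)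
    (- (((x - t * y) * (2 * y - 2 * t * x) / (1 - t ^+ 2) + t) / (1 - t ^+ 2))).
    exact: is_deriveN.
  have d4 := is_derive1_comp (is_derive_expR _) d3.
  apply: is_derive_eq; rewrite /GRing.scale /= (ode t1); ring.
have lt1 (t : R) : 0 <= t -> t <= r -> `|t| < 1.
  by move=> t0 tr; rewrite ger0_norm// (le_lt_trans tr).
have [||c _] := @MVT_segment R h (fun=> 0) 0 r r0.
- by move=> t; rewrite in_itv/= => /andP[t0 tr]; apply: dh; apply: lt1; exact: ltW.
- apply: continuous_in_subspaceT => t; rewrite inE/= in_itv/= => /andP[t0 tr].
  apply: differentiable_continuous; apply/derivable1_diffP.
  by have [] := dh t (lt1 t t0 tr).
rewrite mul0r => /eqP; rewrite subr_eq0 => /eqP.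
have phi0 : phi 0 = 0.
  by rewrite /phi expr0n/= mulr0 mul0r !subr0 ln1 !mul0r subrr.
rewrite /h pser0 phi0 oppr0 expR0 mulr1 => e.
by rewrite -e -mulrA -expRD addNr expR0 mulr1.
Qed.

(** Completing squares in x + y and x - y exhibits the kernel as a normal density centred at x, of
    variance 2 (1 - r) / (1 + r) tending to 0, times factors tending to 1. This is the form in which
    it acts as an approximate identity. *)
Lemma mehler (r : R) : 0 <= r -> r < 1 ->
  \sum_(0 <= n < N) r ^+ n * (hermite_function n x * hermite_function n y) @[N --> \oo] -->
  2 / (1 + r) * expR (- ((1 - r) / (1 + r) * (x + y) ^+ 2 / 4)) *
  normal_pdf x (Num.sqrt (2 * (1 - r) / (1 + r))) y.
Proof.
move=> r0 r1; have nr1 : `|r| < 1 by rewrite ger0_norm.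
set s := Num.sqrt _.
have p0 : 0 < 1 + r by rewrite ltr_pwDl.
have m0 : 0 < 1 - r by rewrite subr_gt0.
have s20 : 0 < 2 * (1 - r) / (1 + r) by rewrite divr_gt0// mulr_gt0.
have s0 : 0 < s by rewrite sqrtr_gt0.
have s2 : s ^+ 2 = 2 * (1 - r) / (1 + r) by rewrite sqr_sqrtr// ltW.
have u0 := one_sub_sqr_gt0 nr1.
rewrite (_ : (fun N => _) = pseries a r); last first.
  apply/funext => N; rewrite /pseries /series/=; apply: eq_bigr => n _.
  by rewrite hermite_functionM mulrC.
suff <- : pser a r = 2 / (1 + r) * expR (- ((1 - r) / (1 + r) * (x + y) ^+ 2 / 4)) *
    normal_pdf x s y by exact: subexponential_cvg.
rewrite pser_expR// normal_pdfE ?gt_eqF//.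
have sq : expR (ln (1 - r ^+ 2) / 2) = Num.sqrt (1 - r ^+ 2).
  have : expR (ln (1 - r ^+ 2) / 2) ^+ 2 = 1 - r ^+ 2.
    by rewrite -expRM_natl mulrC divfK// lnK ?posrE.
  by move=> e; rewrite -[in RHS]e sqrtr_sqr ger0_norm ?expR_ge0.
have sp0 : Num.sqrt pi != 0 :> R by rewrite gt_eqF// sqrtr_gt0 pi_gt0.
have su0 : Num.sqrt (1 - r ^+ 2) != 0 by rewrite gt_eqF// sqrtr_gt0.
have pk : normal_peak s = (2 / (1 + r) * (Num.sqrt (1 - r ^+ 2) * Num.sqrt pi))^-1.
  rewrite /normal_peak s2; congr (_^-1).
  have -> : 2 * (1 - r) / (1 + r) * pi *+ 2 = (2 / (1 + r)) ^+ 2 * ((1 - r ^+ 2) * pi).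
    by field; rewrite gt_eqF.
  rewrite sqrtrM ?sqr_ge0// sqrtr_sqr ger0_norm; last by rewrite divr_ge0// ltW.
  by rewrite (sqrtrM _ (ltW u0)).
rewrite pk /phi expRD expRN sq /a !herm0 /herm_weight expr0 fact0 !mulr1.
set F := (_ / (1 - r ^+ 2)).
have E : expR (- (x ^+ 2 / 2)) * expR (- (y ^+ 2 / 2)) * expR F =
    expR (- ((1 - r) / (1 + r) * (x + y) ^+ 2 / 4)) * normal_fun x s y.
  rewrite /normal_fun s2 -!expRD; congr expR; rewrite /F; field.
  by rewrite !gt_eqF.
apply: (@eq_trans _ _ (expR (- (x ^+ 2 / 2)) * expR (- (y ^+ 2 / 2)) * expR F /
    (Num.sqrt (1 - r ^+ 2) * Num.sqrt pi))).
  by field; rewrite sp0 su0.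
by rewrite E; field; rewrite sp0 su0 !gt_eqF.
Qed.

End mehler.

(** * Parseval's identity for intervals *)

Section hermite_parseval.
Context {R : realType}.
Local Notation mu := (@lebesgue_measure R).

Lemma Rintegral_bigsum (D : set R) (f : nat -> R -> R) (N : nat) : measurable D ->
  (forall n, mu.-integrable D (EFin \o f n)) ->
  mu.-integrable D (EFin \o (fun x => \sum_(0 <= n < N) f n x)) /\
  \int[mu]_(x in D) (\sum_(0 <= n < N) f n x) = \sum_(0 <= n < N) \int[mu]_(x in D) f n x.
Proof.
move=> mD fi; elim: N => [|N [ihi ih]].
  rewrite (_ : (fun x => _) = (fun=> 0)); last by apply/funext => x; rewrite big_geq.
  split; first exact: integrable0.
  rewrite [RHS]big_geq//.
  by rewrite Rintegral_cst// mul0r.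
rewrite (_ : (fun x => _) = (fun x => \sum_(0 <= n < N) f n x + f N x)); last first.
  by apply/funext => x; rewrite big_nat_recr.
split; first exact: integrableD_EFin.
by rewrite [RHS]big_nat_recr//= -ih -RintegralD.
Qed.

Lemma integrable_itv_continuous (f : R -> R) (a b : R) : continuous f ->
  mu.-integrable `[a, b] (EFin \o f).
Proof.
move=> cf; apply: continuous_compact_integrable; first exact: segment_compact.
exact: continuous_subspaceT.
Qed.

Variables a b : R.
Hypothesis ab : a < b.
Local Notation I := (`[a, b]%classic : set R).
Let c n : R := \int[mu]_(x in I) hermite_function n x.
Let L : R := Num.max `|a| `|b|.
Local Notation z := (@hermite_function R).

Let mI : measurable (I : set (measurableTypeR R)).
Proof. exact: measurable_itv. Qed.

Let muI : fine (mu I) = b - a.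
Proof. by rewrite lebesgue_measure_itv/= lte_fin ab. Qed.

Let muIfin : (mu I < +oo)%E.
Proof. by rewrite lebesgue_measure_itv/= lte_fin ab -EFinB ltry. Qed.

Let int_cst (k : R) : mu.-integrable I (EFin \o cst k).
Proof.
apply: measurable_bounded_integrable => //.
exact: bounded_cst.
Qed.

Let IL x : I x -> `|x| <= L.
Proof.
rewrite /= in_itv/= => /andP[ax xb]; rewrite /L le_max.
have [x0|x0] := leP 0 x.
  by rewrite (ger0_norm x0); apply/orP; right; rewrite (le_trans xb)// ler_norm.
rewrite (ltr0_norm x0); apply/orP; left.
by rewrite -normrN (le_trans _ (ler_norm _))// lerN2.
Qed.

Let int_z n : mu.-integrable I (EFin \o z n).
Proof. by apply: integrable_itv_continuous; exact: continuous_hermite_function. Qed.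

(** The constant majorant for dominated convergence: |z_n(x) z_n(y)| is at most the mean of the two
    squares, which grows at rate 2 / (1 + r), and r times that rate is q < 1. *)
Let zbound (r : R) : 0 <= r -> r < 1 ->
  exists2 G : R, 0 <= G & forall N x y, I x -> I y ->
    `|\sum_(0 <= n < N) r ^+ n * (z n x * z n y)| <= G.
Proof.
move=> r0 r1; have p0 : 0 < 1 + r by rewrite ltr_pwDl.
have rho1 : 1 < 2 / (1 + r) by rewrite ltr_pdivlMr// mul1r; lra.
have [K K0 hK] := herm_growth L rho1.
pose q := r * (2 / (1 + r)).
have q0 : 0 <= q by rewrite mulr_ge0// divr_ge0// ltW.
have q1 : q < 1 by rewrite /q mulrA ltr_pdivrMr// mul1r; lra.
exists (K / (1 - q)) => [|N x y Ix Iy]; first by rewrite divr_ge0// subr_ge0 ltW.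
have zz n : `|z n x * z n y| <= K * (2 / (1 + r)) ^+ n.
  have h1 := hK n x (IL Ix); have h2 := hK n y (IL Iy).
  rewrite expr2 -hermite_functionM in h1; rewrite expr2 -hermite_functionM in h2.
  rewrite ler_norml; apply/andP; split.
    have : 0 <= (z n x + z n y) ^+ 2 by exact: sqr_ge0.
    by rewrite sqrrD !expr2 mulr2n => h; lra.
  have : 0 <= (z n x - z n y) ^+ 2 by exact: sqr_ge0.
  by rewrite sqrrB !expr2 mulr2n => h; lra.
apply: (@le_trans _ _ (\sum_(0 <= n < N) K * q ^+ n)).
  rewrite (le_trans (ler_norm_sum _ _ _))// ler_sum// => n _.
  rewrite normrM (ger0_norm (exprn_ge0 n r0)) /q exprMn [leRHS]mulrCA.
  by rewrite ler_wpM2l ?exprn_ge0.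
rewrite -mulr_sumr ler_wpM2l//.
have -> : \sum_(0 <= n < N) q ^+ n = (1 - q ^+ N) / (1 - q).
  have q1' : 1 - q != 0 by rewrite subr_eq0 gt_eqF.
  apply: (mulIf q1'); rewrite divfK//.
  elim: N => [|N ih]; first by rewrite big_geq// expr0 subrr mul0r.
  by rewrite big_nat_recr//= mulrDl ih exprS; ring.
rewrite ler_pdivrMr ?subr_gt0// mulVf ?subr_eq0 ?gt_eqF//.
by rewrite gerBl exprn_ge0.
Qed.

Let M (r x y : R) : R := 2 / (1 + r) * expR (- ((1 - r) / (1 + r) * (x + y) ^+ 2 / 4)) *
  normal_pdf x (Num.sqrt (2 * (1 - r) / (1 + r))) y.

(** Mehler's formula integrated over the square, by dominated convergence first in y for fixed x and
    then in x. *)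
Let abel_sum (r : R) : 0 <= r -> r < 1 ->
  [/\ (forall x, I x -> mu.-integrable I (EFin \o M r x)),
    mu.-integrable I (EFin \o (fun x => \int[mu]_(y in I) M r x y)) &
    \sum_(0 <= n < N) r ^+ n * c n ^+ 2 @[N --> \oo] -->
    \int[mu]_(x in I) (\int[mu]_(y in I) M r x y)].
Proof.
move=> r0 r1; have [G G0 hG] := zbound r0 r1.
pose u x N y := \sum_(0 <= n < N) r ^+ n * (z n x * z n y).
have iu x N : mu.-integrable I (EFin \o u x N) /\
    \int[mu]_(y in I) u x N y = \sum_(0 <= n < N) (r ^+ n * c n) * z n x.
  have [i1 e1] := @Rintegral_bigsum I (fun n y => r ^+ n * (z n x * z n y)) N mI
    (fun n => integrableZl_EFin mI (r ^+ n) (integrableZl_EFin mI (z n x) (int_z n))).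
  split => //; rewrite e1; apply: eq_bigr => n _.
  rewrite RintegralZl//; last exact: integrableZl_EFin.
  by rewrite RintegralZl// -/(c n); ring.
have step1 x : I x -> mu.-integrable I (EFin \o M r x) /\
    \sum_(0 <= n < N) (r ^+ n * c n) * z n x @[N --> \oo] --> \int[mu]_(y in I) M r x y.
  move=> Ix; have [| | |i cv] := @Rdominated_cvg _ _ _ mu I mI (u x) (M r x) (cst G) _ _ (int_cst G) _.
  - by move=> N; apply/measurable_EFinP; exact: measurable_int (iu x N).1.
  - by move=> y Iy; exact: mehler.
  - by move=> N y Iy; exact: hG.
  by split => //; under eq_fun do rewrite -(iu x _).2.
have iv N : mu.-integrable I (EFin \o (fun x => \sum_(0 <= n < N) (r ^+ n * c n) * z n x)) /\
    \int[mu]_(x in I) (\sum_(0 <= n < N) (r ^+ n * c n) * z n x) =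
    \sum_(0 <= n < N) r ^+ n * c n ^+ 2.
  have [i1 e1] := @Rintegral_bigsum I (fun n x => (r ^+ n * c n) * z n x) N mI
    (fun n => integrableZl_EFin mI (r ^+ n * c n) (int_z n)).
  split => //; rewrite e1; apply: eq_bigr => n _.
  by rewrite RintegralZl// -/(c n); ring.
have [| | |i cv] := @Rdominated_cvg _ _ _ mu I mI
  (fun N x => \sum_(0 <= n < N) (r ^+ n * c n) * z n x) (fun x => \int[mu]_(y in I) M r x y)
  (cst (G * (b - a))) _ _ (int_cst _) _.
- by move=> N; apply/measurable_EFinP; exact: measurable_int (iv N).1.
- by move=> x Ix; exact: (step1 x Ix).2.
- move=> N x Ix; rewrite -(iu x N).2 (le_trans (le_normr_Rintegral mI (iu x N).1))//.
  rewrite -muI -(Rintegral_cst mu mI G); apply: le_Rintegral => //.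
  + by apply: integrable_norm; exact: (iu x N).1.
  + exact: int_cst.
  + by move=> y Iy; exact: hG.
split => //; first by move=> x Ix; exact: (step1 x Ix).1.
by under eq_fun do rewrite -(iv _).2.
Qed.

Let S r := \int[mu]_(x in I) (\int[mu]_(y in I) M r x y).

Let int_pdf (x s : R) : mu.-integrable I (EFin \o normal_pdf x s).
Proof. by apply: (integrableS measurableT) => //; exact: integrable_normal_pdf. Qed.

Let Rintegral_pdf (x s : R) :
  \int[mu]_(y in I) normal_pdf x s y = fine (normal_prob x s I).
Proof. by []. Qed.

Let M_ge0 r x y : 0 <= r -> 0 <= M r x y.
Proof.
move=> r0; rewrite /M mulr_ge0 ?normal_pdf_ge0// mulr_ge0 ?expR_ge0//.
by rewrite divr_ge0// addr_ge0.
Qed.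

Let S_le (r : R) : 0 <= r -> r < 1 -> S r <= 2 / (1 + r) * (b - a).
Proof.
move=> r0 r1; have [iM iMM _] := abel_sum r0 r1.
have p0 : 0 < 1 + r by rewrite ltr_pwDl.
have q0 : 0 <= (1 - r) / (1 + r).
  by apply: divr_ge0; [rewrite subr_ge0 ltW|exact: ltW].
rewrite /S -muI -(Rintegral_cst mu mI); apply: le_Rintegral => //; first exact: int_cst.
move=> x Ix; set s := Num.sqrt (2 * (1 - r) / (1 + r)).
apply: (@le_trans _ _ (\int[mu]_(y in I) (2 / (1 + r) * normal_pdf x s y))).
  apply: le_Rintegral => //; first exact: iM.
    exact: integrableZl_EFin.
  move=> y _; rewrite /M ler_wpM2r ?normal_pdf_ge0// ler_piMr ?divr_ge0 ?(ltW p0)//.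
  by rewrite -[leRHS]expR0 ler_expR oppr_le0 divr_ge0// mulr_ge0 ?sqr_ge0.
rewrite RintegralZl// ler_piMr ?divr_ge0 ?(ltW p0)//.
by rewrite Rintegral_pdf -lee_fin fineK ?probability_le1// fin_num_measure.
Qed.

Let S_ge0 (r : R) : 0 <= r -> 0 <= S r.
Proof. by move=> r0; apply: Rintegral_ge0 => x _; apply: Rintegral_ge0 => y _; exact: M_ge0. Qed.

(** For x at distance at least [del] from both ends, the normal density keeps mass 1 - 6 s^2 / del^2
    inside the interval, and s^2 <= 2 (1 - r) accounts for the 12. The exponential factor is at
    least exp(-(1 - r) L^2) because |x + y| / 2 <= L, and 2 / (1 + r) >= 1. *)
Let S_ge (r del : R) : 0 <= r -> r < 1 -> 0 < del -> a + del <= b - del ->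
  (b - a - 2 * del) * (expR (- ((1 - r) * L ^+ 2)) * (1 - 12 * (1 - r) / del ^+ 2)) <= S r.
Proof.
move=> r0 r1 d0 abd.
have p0 : 0 < 1 + r by rewrite ltr_pwDl.
have m0 : 0 < 1 - r by rewrite subr_gt0.
have [neg|pos] := ltP (1 - 12 * (1 - r) / del ^+ 2) 0.
  rewrite (le_trans _ (S_ge0 r0))// mulr_ge0_le0//; first lra.
  by rewrite mulr_ge0_le0 ?expR_ge0// ltW.
have [iM iMM _] := abel_sum r0 r1.
set k := expR _ * _.
have k0 : 0 <= k by rewrite mulr_ge0 ?expR_ge0.
have s20 : 0 < 2 * (1 - r) / (1 + r) by rewrite divr_gt0// mulr_gt0.
pose s := Num.sqrt (2 * (1 - r) / (1 + r)).
have s0 : 0 < s by rewrite sqrtr_gt0.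
have s2 : s ^+ 2 = 2 * (1 - r) / (1 + r) by rewrite sqr_sqrtr// ltW.
pose J : set R := `[(a + del), (b - del)]%classic.
have mJ : measurable (J : set (measurableTypeR R)) by exact: measurable_itv.
have JI : J `<=` I.
  move=> x; rewrite /J /= !in_itv/= => /andP[h1 h2]; lra.
have muJ : fine (mu J) = b - a - 2 * del.
  rewrite /J lebesgue_measure_itv/= lte_fin.
  have [lt|gt|eq] := ltgtP (a + del) (b - del); rewrite /=; lra.
have intJ : mu.-integrable I (EFin \o (k \o* \1_J)).
  apply: measurable_bounded_integrable => //.
    by apply: measurable_funTS; apply: measurable_funM => //; exact: measurable_indic.
  exists `|k|; split; first by rewrite num_real.
  move=> t kt x _ /=; rewrite normrM (le_trans _ (ltW kt))// ler_piMl//.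
  by rewrite indicE; case: (_ \in _); rewrite ?normr1 ?normr0.
have -> : (b - a - 2 * del) * k = \int[mu]_(x in I) (k \o* \1_J) x.
  rewrite /Rintegral; under eq_integral do rewrite /= EFinM.
  rewrite integralZr//; last first.
    apply: measurable_bounded_integrable => //.
    exists 1; split => // t t1 x _ /=; rewrite (le_trans _ (ltW t1))//.
    by rewrite indicE; case: (_ \in _); rewrite ?normr1 ?normr0.
  rewrite integral_indic// setIidl// fineM//=; first by rewrite muJ.
  rewrite ge0_fin_numE// (le_lt_trans _ muIfin)//.
  by rewrite le_measure ?inE.
rewrite /S; apply: le_Rintegral => // x Ix.
rewrite /= indicE.
case: (boolP (x \in J)) => [/set_mem xJ|_]; last first.
  by rewrite mul0r; apply: Rintegral_ge0 => y _; exact: M_ge0.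
rewrite mul1r.
apply: (@le_trans _ _ (\int[mu]_(y in I) (expR (- ((1 - r) * L ^+ 2)) * normal_pdf x s y))); last first.
  apply: le_Rintegral => //; [exact: integrableZl_EFin|exact: iM|].
  move=> y Iy; rewrite /M ler_wpM2r ?normal_pdf_ge0//.
  rewrite (@le_trans _ _ (expR (- ((1 - r) / (1 + r) * (x + y) ^+ 2 / 4))))//.
    rewrite ler_expR lerN2.
    have xy : (x + y) ^+ 2 / 4 <= L ^+ 2.
      have -> : (x + y) ^+ 2 / 4 = ((x + y) / 2) ^+ 2 by field.
      rewrite -(real_normK (num_real ((x + y) / 2))) lerXn2r ?nnegrE//.
        by rewrite (le_trans _ (IL Ix)).
      have h1 := IL Ix; have h2 := IL Iy.
      rewrite normrM (ger0_norm (x := 2^-1))// (le_trans (ler_wpM2r _ (ler_normD _ _)))//; lra.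
    rewrite -mulrA; apply: ler_pM => //.
    - by apply: divr_ge0; exact: ltW.
    - by rewrite divr_ge0// sqr_ge0.
    - by rewrite ler_pdivrMr// ler_peMr ?(ltW m0)// lerDl.
  by rewrite ler_peMl ?expR_ge0// ler_pdivlMr// mul1r; lra.
rewrite RintegralZl// /k ler_wpM2l ?expR_ge0//.
rewrite Rintegral_pdf -lee_fin fineK ?fin_num_measure//.
move: xJ; rewrite /J /= in_itv/= => /andP[ax xb].
have ax' : a <= x - del by rewrite lerBrDr.
have xb' : x + del <= b by rewrite -lerBrDr.
have := normal_prob_oo_ge s0 d0 ax' xb'.
have : (normal_prob x s `]a, b[%classic <= normal_prob x s I)%E.
  rewrite le_measure ?inE//.
  by apply: subset_itvW; rewrite ?bnd_simp.
move=> h2 h1; apply: le_trans (le_trans h1 h2).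
rewrite lee_fin s2 lerD2l lerN2 ler_wpM2r ?invr_ge0 ?sqr_ge0//.
rewrite mulrA ler_pdivrMr// mulrA -natrM ler_peMr//; first by rewrite mulr_ge0// ltW.
by rewrite lerDl.
Qed.

(* The weighted sums S r are squeezed towards b - a as r tends to 1; since the terms
   are nonnegative, Abel summation can be undone. *)
Lemma hermite_parseval_itv :
  \sum_(0 <= n < N) c n ^+ 2 @[N --> \oo] --> b - a.
Proof.
pose rk (k : nat) : R := 1 - (@harmonic R k.+1).
have hk0 k : 0 < @harmonic R k by rewrite /harmonic invr_gt0 ltr0n.
have rk0 k : 0 <= rk k by rewrite /rk subr_ge0 /harmonic invf_le1 ?ler1n ?ltr0n.
have rk1 k : rk k < 1 by rewrite /rk ltrBlDr ltrDl.
have ch : @harmonic R k.+1 @[k --> \oo] --> 0 by rewrite (cvg_shiftS (@harmonic R)); exact: cvg_harmonic.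
have crk : rk k @[k --> \oo] --> (1 : R).
  by rewrite -[X in _ --> X](subr0 1); apply: cvgB => //; exact: cvg_cst.
have nd : nondecreasing_seq (fun N => \sum_(0 <= n < N) c n ^+ 2).
  by apply: nondecreasing_series => n _ _; exact: sqr_ge0.
have ndr r : 0 <= r -> nondecreasing_seq (fun N => \sum_(0 <= n < N) r ^+ n * c n ^+ 2).
  move=> r0; apply: nondecreasing_series => n _ _.
  by rewrite mulr_ge0 ?sqr_ge0// exprn_ge0.
(* With N fixed, the truncated sum at r is at most S r <= 2 (b - a) / (1 + r); then r tends to 1. *)
have partial_le N : \sum_(0 <= n < N) c n ^+ 2 <= b - a.
  have c1 : \sum_(0 <= n < N) rk k ^+ n * c n ^+ 2 @[k --> \oo] -->
      \sum_(0 <= n < N) 1 ^+ n * c n ^+ 2.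
    elim: N => [|N ih].
      rewrite big_geq//; under eq_fun do rewrite big_geq//.
      exact: cvg_cst.
    rewrite big_nat_recr//=; under eq_fun do rewrite big_nat_recr//=.
    apply: cvgD => //; apply: cvgMl.
    exact: (cvg_comp _ _ crk (@exprn_continuous R N 1)).
  have c2 : 2 / (1 + rk k) * (b - a) @[k --> \oo] --> 2 / (1 + 1) * (b - a).
    apply: cvgMl; apply: cvgMr; apply: cvgV; first by rewrite gt_eqF.
    by apply: cvgD => //; exact: cvg_cst.
  have e1 : \sum_(0 <= n < N) 1 ^+ n * c n ^+ 2 = \sum_(0 <= n < N) c n ^+ 2.
    by apply: eq_bigr => n _; rewrite expr1n mul1r.
  have e2 : 2 / (1 + 1) * (b - a) = b - a by field.
  rewrite -e1 -[leRHS]e2 -(cvg_lim _ c1)// -(cvg_lim _ c2)//; apply: ler_lim.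
  - by apply/cvg_ex; eexists; exact: c1.
  - by apply/cvg_ex; eexists; exact: c2.
  - apply: nearW => k; apply: le_trans (S_le (rk0 k) (rk1 k)).
    have [_ _ cv] := abel_sum (rk0 k) (rk1 k).
    rewrite /S -(cvg_lim _ cv)//; apply: nondecreasing_cvgn_le; first exact: ndr.
    by apply/cvg_ex; eexists; exact: cv.
have cvS : cvgn (fun N => \sum_(0 <= n < N) c n ^+ 2).
  by apply: nondecreasing_is_cvgn => //; exists (b - a) => _ [N _ <-].
suff -> : b - a = limn (fun N => \sum_(0 <= n < N) c n ^+ 2) by exact: cvS.
apply/eqP; rewrite eq_le; apply/andP; split; last by apply: limr_le => //; exact: nearW.
set l := limn _.
have S_l r : 0 <= r -> r < 1 -> S r <= l.
  move=> r0 r1; have [_ _ cv] := abel_sum r0 r1.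
  rewrite /S -(cvg_lim _ cv)//; apply: ler_lim => //.
    by apply/cvg_ex; eexists; exact: cv.
  apply: nearW => N; apply: ler_sum => n _.
  by rewrite ler_piMl ?sqr_ge0// exprn_ile1// ltW.
rewrite leNgt; apply/negP => lt.
have l0 : 0 <= l by rewrite (le_trans (S_ge0 (rk0 0%N)))// S_l.
(* In the limit [S_ge] yields b - a - 2 del <= l, but for this [del] the left side is the midpoint
   of l and b - a, hence larger than l. Nonnegativity of l ensures a + del <= b - del. *)
pose del := (b - a - l) / 4.
have d0 : 0 < del by rewrite divr_gt0// subr_gt0.
have abd : a + del <= b - del by rewrite /del; lra.
have c3 : (b - a - 2 * del) * (expR (- (@harmonic R k.+1 * L ^+ 2)) *
    (1 - 12 * @harmonic R k.+1 / del ^+ 2)) @[k --> \oo] -->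
    (b - a - 2 * del) * (expR (- (0 * L ^+ 2)) * (1 - 12 * 0 / del ^+ 2)).
  apply: cvgMr; apply: cvgM.
    have cN : - (@harmonic R k.+1 * L ^+ 2) @[k --> \oo] --> - (0 * L ^+ 2).
      by apply: cvgN; exact: cvgMl.
    exact: (cvg_comp _ _ cN (@continuous_expR R _)).
  apply: cvgB; first exact: cvg_cst.
  by apply: cvgMl; exact: cvgMr.
have : (b - a - 2 * del) * (expR (- (0 * L ^+ 2)) * (1 - 12 * 0 / del ^+ 2)) <= l.
  rewrite -(cvg_lim _ c3)//; apply: limr_le; first by apply/cvg_ex; eexists; exact: c3.
  apply: nearW => k.
  have := S_ge (rk0 k) (rk1 k) d0 abd.
  have -> : 1 - rk k = @harmonic R k.+1 by rewrite /rk; ring.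
  by move=> /le_trans; apply; exact: S_l.
rewrite mul0r oppr0 expR0 mulr0 mul0r subr0 !mulr1 /del; lra.
Qed.

End hermite_parseval.

(** * Square integrable variables and white noise *)

Section square_integrable.
Context d {T : measurableType d} {R : realType} (P : probability T R).
Implicit Types X Y Z : T -> R.
Local Notation L2 := (Lfun P 2%:E).

Lemma Lfun2_measurable X : X \in L2 -> measurable_fun setT X.
Proof. by rewrite inE => /andP[]; rewrite inE. Qed.

Lemma Lfun2_integrable_mul X Y : X \in L2 -> Y \in L2 ->
  P.-integrable setT (EFin \o (fun w => X w * Y w)).
Proof. by move=> X2 Y2; exact/Lfun1_integrable/(Lfun2_mul_Lfun1 X2 Y2). Qed.

Lemma Lfun2_lin (a : R) X Y : X \in L2 -> Y \in L2 -> (fun w => a * X w + Y w) \in L2.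
Proof.
move=> X2 Y2.
have := @Lfun_submod_closed _ _ _ P 2%:E (lee1n 2); move=> [_ h].
exact: (h a _ _ X2 Y2).
Qed.

Lemma Lfun2_sub X Y : X \in L2 -> Y \in L2 -> (fun w => X w - Y w) \in L2.
Proof.
move=> X2 Y2; rewrite (_ : (fun w => _) = (fun w => -1 * Y w + X w)).
  exact: Lfun2_lin.
by apply/funext => w; ring.
Qed.

Lemma Lfun2_sum (a : nat -> R) (F : nat -> T -> R) N : (forall n, F n \in L2) ->
  (fun w => \sum_(n < N) a n * F n w) \in L2.
Proof.
move=> F2; elim: N => [|N ih].
  rewrite (_ : (fun w => _) = cst 0); last by apply/funext => w; rewrite big_ord0.
  exact: Lfun_cst.
rewrite (_ : (fun w => _) = (fun w => a N * F N w + \sum_(n < N) a n * F n w)).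
  exact: Lfun2_lin.
by apply/funext => w; rewrite big_ord_recr/= addrC.
Qed.

Lemma Lnorm2E X : X \in L2 ->
  ('N[P]_2%:E[EFin \o X] = (Num.sqrt (\int[P]_w (X w * X w)%R))%:E)%E.
Proof.
move=> X2; rewrite unlock /Lnorm.
have -> : (\int[P]_w (`|(EFin \o X) w| `^ 2) = (\int[P]_w (X w * X w)%R)%:E)%E.
  rewrite /Rintegral fineK.
    apply: eq_integral => w _ /=; congr (_%:E).
    by rewrite powR_mulrn// real_normK ?num_real// expr2.
  exact: (integrable_fin_num _ (Lfun2_integrable_mul X2 X2)).
by rewrite /= powR12_sqrt// Rintegral_ge0// => w _; rewrite -expr2 sqr_ge0.
Qed.

Lemma Rintegral_ae_eq X Y : measurable_fun setT X -> measurable_fun setT Y ->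
  {ae P, forall w, X w = Y w} -> \int[P]_w X w = \int[P]_w Y w.
Proof.
move=> mX mY XY; rewrite /Rintegral; congr fine; apply: ae_eq_integral => //.
- exact/measurable_EFinP.
- exact/measurable_EFinP.
- by apply: filterS XY => w /= -> _.
Qed.

Lemma ae_eq_of_Rintegral_sqr X Y : X \in L2 -> Y \in L2 ->
  \int[P]_w ((X w - Y w) * (X w - Y w)) = 0 -> {ae P, forall w, X w = Y w}.
Proof.
move=> X2 Y2 h0; have XY2 := Lfun2_sub X2 Y2.
have := Lnorm2E XY2; rewrite h0 sqrtr0 => /Lnorm_eq0_eq0 h.
have mXY := Lfun2_measurable XY2.
have : (EFin \o (fun w => X w - Y w)) = \0%E %[ae P].
  by apply: h => //; exact/measurable_EFinP.
apply: filterS => w /= /(_ I) [] h'.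
by apply/eqP; rewrite -subr_eq0 h'.
Qed.

Lemma Rintegral_sqr_lincomb (a : R) X Y Z : X \in L2 -> Y \in L2 -> Z \in L2 ->
  \int[P]_w ((X w - (a * Y w + Z w)) * (X w - (a * Y w + Z w))) =
  \int[P]_w (X w * X w) + a ^+ 2 * \int[P]_w (Y w * Y w) + \int[P]_w (Z w * Z w)
  - 2 * a * \int[P]_w (X w * Y w) - 2 * \int[P]_w (X w * Z w)
  + 2 * a * \int[P]_w (Y w * Z w).
Proof.
move=> X2 Y2 Z2.
have xx := Lfun2_integrable_mul X2 X2; have yy := Lfun2_integrable_mul Y2 Y2.
have zz := Lfun2_integrable_mul Z2 Z2; have xy := Lfun2_integrable_mul X2 Y2.
have xz := Lfun2_integrable_mul X2 Z2; have yz := Lfun2_integrable_mul Y2 Z2.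
rewrite -!RintegralZl//.
have m := @measurableT _ T.
have i1 := integrableZl_EFin m (a ^+ 2) yy.
have i2 := integrableZl_EFin m (2 * a) xy.
have i3 := integrableZl_EFin m 2 xz.
have i4 := integrableZl_EFin m (2 * a) yz.
have j1 := integrableD_EFin m xx i1; rewrite -(RintegralD m xx i1).
have j2 := integrableD_EFin m j1 zz; rewrite -(RintegralD m j1 zz).
have j3 := integrableB_EFin m j2 i2; rewrite -(RintegralB m j2 i2).
have j4 := integrableB_EFin m j3 i3; rewrite -(RintegralB m j3 i3).
rewrite -(RintegralD m j4 i4).
by apply: eq_Rintegral => w _; ring.
Qed.

(** The pointwise bound (X - Y)^2 <= 2 (S - X)^2 + 2 (S - Y)^2, once integrated, stands in for the
    triangle inequality. *)
Lemma L2_limit_unique (S : nat -> T -> R) X Y :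
  (forall N, S N \in L2) -> X \in L2 -> Y \in L2 ->
  \int[P]_w ((S N w - X w) * (S N w - X w)) @[N --> \oo] --> 0 ->
  \int[P]_w ((S N w - Y w) * (S N w - Y w)) @[N --> \oo] --> 0 ->
  {ae P, forall w, X w = Y w}.
Proof.
move=> S2 X2 Y2 cX cY; apply: ae_eq_of_Rintegral_sqr => //.
set I := \int[P]_w _.
have I0 : 0 <= I by apply: Rintegral_ge0 => w _; rewrite -expr2 sqr_ge0.
have cXY : 2 * \int[P]_w ((S N w - X w) * (S N w - X w)) +
    2 * \int[P]_w ((S N w - Y w) * (S N w - Y w)) @[N --> \oo] --> (2 * 0 + 2 * 0 : R).
  by apply: cvgD; exact: cvgMr.
apply/eqP; rewrite eq_le I0 andbT.
have <- : 2 * 0 + 2 * 0 = 0 :> R by ring.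
rewrite -(cvg_lim _ cXY)//; apply: limr_ge; first by apply/cvg_ex; eexists; exact: cXY.
apply: nearW => N.
have SX := Lfun2_sub (S2 N) X2; have SY := Lfun2_sub (S2 N) Y2.
have XY := Lfun2_sub X2 Y2.
have iX := Lfun2_integrable_mul SX SX; have iY := Lfun2_integrable_mul SY SY.
have m := @measurableT _ T.
rewrite -!RintegralZl// -RintegralD//; [|exact: integrableZl_EFin..].
apply: le_Rintegral => //.
- exact: Lfun2_integrable_mul.
- by apply: integrableD_EFin => //; exact: integrableZl_EFin.
move=> w _; have : 0 <= ((S N w - X w) + (S N w - Y w)) ^+ 2 by exact: sqr_ge0.
by rewrite !expr2; nra.
Qed.

Lemma Lnorm2_cvg0P (S : nat -> T -> R) X : (forall N, S N \in L2) -> X \in L2 ->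
  (('N[P]_2%:E[EFin \o (fun w => S N w - X w)%R])%E @[N --> \oo] --> 0%E) <->
  \int[P]_w ((S N w - X w) * (S N w - X w)) @[N --> \oo] --> 0.
Proof.
move=> S2 X2.
have E N : ('N[P]_2%:E[EFin \o (fun w => S N w - X w)%R])%E =
  (Num.sqrt (\int[P]_w ((S N w - X w) * (S N w - X w))%R))%:E.
  exact: (Lnorm2E (Lfun2_sub (S2 N) X2)).
have I0 N : 0 <= \int[P]_w ((S N w - X w) * (S N w - X w)).
  by apply: Rintegral_ge0 => w _; rewrite -expr2 sqr_ge0.
under eq_fun do rewrite E.
split => [/fine_cvgP[_ /= h]|h].
  have h2 := cvgM h h; rewrite mulr0 in h2.
  suff <- : (fun N => Num.sqrt (\int[P]_w ((S N w - X w) * (S N w - X w)))) \*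
    (fun N => Num.sqrt (\int[P]_w ((S N w - X w) * (S N w - X w)))) =
    (fun N => \int[P]_w ((S N w - X w) * (S N w - X w))) by exact: h2.
  by apply/funext => N /=; rewrite -expr2 sqr_sqrtr.
apply: cvg_EFin; first exact: nearW.
have := cvg_comp _ _ h (@sqrt_continuous R 0).
by rewrite sqrtr0.
Qed.

(** Pointwise |X| <= X^2 / (2 del) + del / 2, and the total mass is 1. *)
Lemma Rintegral_abs_le X (del : R) : X \in L2 -> 0 < del ->
  \int[P]_w (X w * X w) <= del ^+ 2 -> \int[P]_w `|X w| <= del.
Proof.
move=> X2 d0 Xd; have XX := Lfun2_integrable_mul X2 X2.
have m := @measurableT _ T.
have mX := Lfun2_measurable X2.
have iX : P.-integrable setT (EFin \o X).
  by apply/Lfun1_integrable; apply: Lfun_subset12 => //; exact: fin_num_measure.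
have ic : P.-integrable setT (EFin \o (fun w => (2 * del)^-1 * (X w * X w) + del / 2)).
  apply: integrableD_EFin => //; first exact: integrableZl_EFin.
  exact: finite_measure_integrable_cst.
apply: (@le_trans _ _ (\int[P]_w ((2 * del)^-1 * (X w * X w) + del / 2))).
  apply: le_Rintegral => //; first exact: integrable_norm.
  move=> w _; have : 0 <= (`|X w| - del) ^+ 2 by exact: sqr_ge0.
  rewrite sqrrB real_normK ?num_real// -expr2 => h.
  have -> : (2 * del)^-1 * X w ^+ 2 + del / 2 = (X w ^+ 2 + del ^+ 2) / (2 * del).
    by field; rewrite gt_eqF.
  rewrite ler_pdivlMr ?mulr_gt0//; lra.
rewrite RintegralD//; [|exact: integrableZl_EFin|exact: finite_measure_integrable_cst].
rewrite (RintegralZl _ m XX).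
have : \int[P]_w (del / 2) = del / 2 * fine (P setT) by exact: (Rintegral_cst P m).
rewrite probability_setT mulr1 => /eqP; rewrite eq_le => /andP[E _].
apply: (@le_trans _ _ ((2 * del)^-1 * del ^+ 2 + del / 2)).
  apply: lerD; last exact: E.
  by apply: ler_wpM2l => //; rewrite invr_ge0 mulr_ge0// ltW.
have -> : (2 * del)^-1 * del ^+ 2 + del / 2 = del by field; rewrite gt_eqF.
by [].
Qed.

Lemma gaussian_rv_char X (s : R) : measurable_fun setT X -> 0 <= s ->
  \int[P]_w (X w * X w) = s ^+ 2 -> X \in L2 ->
  (forall t : R, \int[P]_w cos (t * X w) = expR (- (s ^+ 2 * t ^+ 2 / 2))) ->
  (forall t : R, \int[P]_w sin (t * X w) = 0) ->
  gaussian_rv P X.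
Proof.
move=> mX s0 Xs X2 hc hs; split => //; exists 0, s; split => // A mA.
(* For s = 0 the second moment forces X = 0 almost surely, and the law is the Dirac mass at 0. *)
have [s00|sn0] := eqVneq s 0; last first.
  by apply: (pushforward_normal_prob mX _ hc hs mA); rewrite lt0r sn0.
have X0 : {ae P, forall w, X w = cst 0 w}.
  apply: ae_eq_of_Rintegral_sqr => //; first exact: Lfun_cst.
  under eq_Rintegral do rewrite /= subr0.
  by rewrite Xs s00 expr0n.
have mXA : measurable (X @^-1` A) by rewrite -[X in measurable X]setTI; exact: mX.
rewrite /pushforward diracE.
have ->: P (X @^-1` A) = (\int[P]_w (\1_(X @^-1` A) w)%:E)%E by rewrite integral_indic// setIT.
rewrite (ae_eq_integral (fun=> ((0 : R) \in A)%:R%:E)) //=; last 2 first.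
- by apply/measurable_EFinP; exact: measurable_indic.
- apply: filterS X0 => w /= Xw _; rewrite indicE.
  by have -> : (w \in X @^-1` A) = ((0 : R) \in A) by apply/idP/idP; rewrite !inE /= Xw.
by rewrite integral_cst//= probability_setT mule1.
Qed.

End square_integrable.

(** * Orthonormal series *)

Section hilbert_dot.
Context {R : realType} {V : lmodType R} {form : V -> V -> R}.
Variable H : hilbert_completion form.
Implicit Types x y : H.

Lemma hc_dotDr x y z : hc_dot x (y + z) = hc_dot x y + hc_dot x z.
Proof. by rewrite hc_dotC hc_dotDl !(hc_dotC x). Qed.

Lemma hc_dotZr (a : R) x y : hc_dot x (a *: y) = a * hc_dot x y.
Proof. by rewrite hc_dotC hc_dotZl hc_dotC. Qed.

Lemma hc_dotNr x y : hc_dot x (- y) = - hc_dot x y.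
Proof. by rewrite -scaleN1r hc_dotZr mulN1r. Qed.

Lemma hc_dotNl x y : hc_dot (- x) y = - hc_dot x y.
Proof. by rewrite hc_dotC hc_dotNr hc_dotC. Qed.

Lemma hc_normB x y : `|x - y| ^+ 2 = `|x| ^+ 2 + `|y| ^+ 2 - 2 * hc_dot x y.
Proof.
rewrite -!hc_dot_norm !hc_dotDl !hc_dotDr !hc_dotNl !hc_dotNr (hc_dotC y x); ring.
Qed.

Lemma hc_dotE x y : hc_dot x y = (`|x| ^+ 2 + `|y| ^+ 2 - `|x - y| ^+ 2) / 2.
Proof. by rewrite hc_normB; field. Qed.

Variable g : nat -> H.
Hypothesis hg : forall m n, hc_dot (g m) (g n) = (m == n)%:R.

Lemma hc_dot_sum_orthonormal (c : nat -> R) m n j : (n <= j)%N ->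
  hc_dot (\sum_(m <= k < n) c k *: g k) (g j) = 0.
Proof.
elim: n => [|n ih] nj.
  by rewrite big_geq// -(scale0r (g j)) hc_dotZl mul0r.
have [mn|nm] := leqP m n; last by rewrite big_geq// -(scale0r (g j)) hc_dotZl mul0r.
rewrite big_nat_recr//= hc_dotDl ih ?(ltnW nj)// hc_dotZl hg.
by rewrite (ltn_eqF nj) mulr0 addr0.
Qed.

Lemma norm_sum_orthonormal (c : nat -> R) m n :
  `|\sum_(m <= k < n) c k *: g k| ^+ 2 = \sum_(m <= k < n) c k ^+ 2.
Proof.
elim: n => [|n ih]; first by rewrite !big_geq// normr0 expr0n.
have [mn|nm] := leqP m n; last by rewrite !big_geq// normr0 expr0n.
rewrite !big_nat_recr//= -ih -!hc_dot_norm !hc_dotDl !hc_dotDr.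
rewrite (hc_dotC (c n *: g n) (\sum_(m <= k < n) c k *: g k)).
rewrite !hc_dotZr !hc_dotZl hc_dot_sum_orthonormal// hg eqxx.
by rewrite !mulr0 add0r addr0 mulr1.
Qed.

(** A block of the vector series has as squared norm the corresponding block of squares, so the
    Cauchy criterion transfers and completeness concludes. *)
Lemma cvg_sum_orthonormal (c : nat -> R) : cvgn (series (fun n => c n ^+ 2)) ->
  cvgn (series (fun n => c n *: g n)).
Proof.
move=> /cauchy_cvgP/cauchy_seriesP cc; apply/cauchy_cvgP/cauchy_seriesP => e e0.
have := cc _ (exprn_gt0 2 e0); apply: filterS => -[n m] /=.
rewrite ger0_norm; last by apply: sumr_ge0 => i _; exact: sqr_ge0.
by rewrite -norm_sum_orthonormal ltr_pXn2r ?nnegrE// ltW.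
Qed.

End hilbert_dot.

(** * The white noise isometry *)

Section white_noise_gaussian.
Context {R : realType} (sigma : {measure set (measurableTypeR R) -> \bar R}).
Variable P : probability (temperedM R) R.
Hypothesis hP : is_white_noise_measure sigma P.
Variable H : white_noise_hilbert sigma.
Variable Q : H -> temperedM R -> R.
Hypothesis hQ : is_white_noise_isometry P Q.
Local Notation L2 := (Lfun P 2%:E).

Let Q2 h : Q h \in L2. Proof. by have [] := hQ. Qed.

Lemma white_noise_isometry_dist h h' : \int[P]_w ((Q h w - Q h' w) * (Q h w - Q h' w)) = `|h - h'| ^+ 2.
Proof.
have [_ _ iso] := hQ; have := iso h h'.
rewrite (Lnorm2E (Lfun2_sub (Q2 h) (Q2 h'))) => -[] <-.
by rewrite sqr_sqrtr// Rintegral_ge0// => w _; rewrite -expr2 sqr_ge0.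
Qed.

Let Q_embed s : {ae P, forall w, Q (hc_embed H s) w = (w : tempered R) s}.
Proof. by have [_ + _] := hQ; apply. Qed.

(** Distances alone do not locate the origin; evaluation at the zero test function does. *)
Let Q0 : {ae P, forall w, Q 0 w = cst 0 w}.
Proof.
by have := Q_embed 0; rewrite linear0; apply: filterS => w ->; rewrite linear0.
Qed.

Let measurableQ h : measurable_fun setT (Q h).
Proof. exact: Lfun2_measurable. Qed.

Let Qsqr h : \int[P]_w (Q h w * Q h w) = `|h| ^+ 2.
Proof.
rewrite -[h in RHS]subr0 -white_noise_isometry_dist; apply: Rintegral_ae_eq.
- exact: measurable_funM.
- by apply: measurable_funM; apply: measurable_funB.
- by apply: filterS Q0 => w /= ->; rewrite subr0.
Qed.

Lemma white_noise_isometry_dot h h' : \int[P]_w (Q h w * Q h' w) = hc_dot h h'.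
Proof.
have m := @measurableT _ (temperedM R).
have XX := Lfun2_integrable_mul (Q2 h) (Q2 h).
have YY := Lfun2_integrable_mul (Q2 h') (Q2 h').
have XY := Lfun2_integrable_mul (Q2 h) (Q2 h').
have DD := Lfun2_integrable_mul (Lfun2_sub (Q2 h) (Q2 h')) (Lfun2_sub (Q2 h) (Q2 h')).
have i1 := integrableD_EFin m XX YY.
rewrite hc_dotE -(white_noise_isometry_dist h h') -!Qsqr -(RintegralD m XX YY) -(RintegralB m i1 DD).
rewrite mulrC -(RintegralZl _ m (integrableB_EFin m i1 DD)).
by apply: eq_Rintegral => w _; field.
Qed.

(** The second moment of the defect expands into inner products, which cancel exactly as in H. *)
Lemma white_noise_isometry_lin (a : R) h h' :
  {ae P, forall w, Q (a *: h + h') w = a * Q h w + Q h' w}.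
Proof.
apply: ae_eq_of_Rintegral_sqr => //; first exact: Lfun2_lin.
rewrite Rintegral_sqr_lincomb// !white_noise_isometry_dot.
rewrite !hc_dotDl !hc_dotDr !hc_dotZl !hc_dotZr (hc_dotC h' h); ring.
Qed.

Lemma white_noise_isometry_sum (a : nat -> R) (f : nat -> H) N :
  {ae P, forall w, Q (\sum_(n < N) a n *: f n) w = \sum_(n < N) a n * Q (f n) w}.
Proof.
elim: N => [|N ih].
  by apply: filterS Q0 => w; rewrite !big_ord0.
apply: filterS2 ih (white_noise_isometry_lin (a N) (f N) (\sum_(n < N) a n *: f n)).
by move=> w h1; rewrite !big_ord_recr/= addrC => ->; rewrite h1 addrC.
Qed.

Let measurable_eval (s : schwartz R) :
  measurable_fun setT (fun w : temperedM R => (w : tempered R) s).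
Proof.
move=> _ B mB; rewrite setTI; apply: sub_sigma_algebra.
by exists s, B.
Qed.

Let schwartz_form_norm (s : schwartz R) :
  (\int[sigma]_u (Normc.normc (fourier s u) ^+ 2)) = `|hc_embed H s| ^+ 2.
Proof.
rewrite -hc_dot_norm hc_embed_dot /schwartz_form /cintegral /=.
apply: eq_Rintegral => u _; case: (fourier s u) => x y /=.
by rewrite sqr_sqrtr ?addr_ge0 ?sqr_ge0//; ring.
Qed.

Let measurable_cos_mul (X : temperedM R -> R) (t : R) : measurable_fun setT X ->
  measurable_fun setT (fun w => cos (t * X w)).
Proof.
move=> mX; apply: (@measurableT_comp _ _ _ _ _ _ (@cos R)); last exact: measurable_funM.
by apply: continuous_measurable_fun; exact: continuous_cos.
Qed.

Let measurable_sin_mul (X : temperedM R -> R) (t : R) : measurable_fun setT X ->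
  measurable_fun setT (fun w => sin (t * X w)).
Proof.
move=> mX; apply: (@measurableT_comp _ _ _ _ _ _ (@sin R)); last exact: measurable_funM.
by apply: continuous_measurable_fun; exact: continuous_sin.
Qed.

(** The defining identity of P gives the characteristic function at argument 1 only; applying it to
    t s and using linearity of w reaches every t. *)
Let char_embed (s : schwartz R) (t : R) :
  \int[P]_w cos (t * Q (hc_embed H s) w) =
    expR (- (`|hc_embed H s| ^+ 2 * t ^+ 2 / 2)) /\
  \int[P]_w sin (t * Q (hc_embed H s) w) = 0.
Proof.
have nE : `|hc_embed H (t *: s)| ^+ 2 = t ^+ 2 * `|hc_embed H s| ^+ 2.
  by rewrite -!hc_dot_norm linearZ hc_dotZl hc_dotZr; ring.
have := hP (t *: s); rewrite schwartz_form_norm nE.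
rewrite /cintegral => -[e1 e2].
have ev w : (w : tempered R) (t *: s) = t * (w : tempered R) s by rewrite linearZ.
split.
  have -> : \int[P]_w cos (t * Q (hc_embed H s) w) =
      \int[P]_w cos (t * (w : tempered R) s).
    apply: Rintegral_ae_eq; [exact: measurable_cos_mul..|].
    by apply: filterS (Q_embed s) => w ->.
  under eq_Rintegral do rewrite -ev.
  by rewrite -e1; congr expR; field.
have -> : \int[P]_w sin (t * Q (hc_embed H s) w) =
    \int[P]_w sin (t * (w : tempered R) s).
  apply: Rintegral_ae_eq; [exact: measurable_sin_mul..|].
  by apply: filterS (Q_embed s) => w ->.
under eq_Rintegral do rewrite -ev.
by rewrite -e2.
Qed.

Let embed_approx (h : H) : exists s : nat -> schwartz R,
  forall k, `|h - hc_embed H (s k)| <= k.+1%:R^-1.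
Proof.
have ex k : exists s : schwartz R, `|h - hc_embed H s| <= k.+1%:R^-1.
  have k0 : (0 : R) < k.+1%:R^-1 by rewrite invr_gt0 ltr0n.
  have D : dense (range (hc_embed H)) by exact: hc_embed_dense.
  have O : open (ball h (k.+1%:R^-1)) by exact: ball_open.
  have [|y [hb [s _ sy]]] := D (ball h (k.+1%:R^-1)) _ O.
    by exists h; exact: ballxx.
  by exists s; rewrite sy; apply: ltW; move: hb; rewrite -ball_normE.
have [s hs] := choice ex; by exists s.
Qed.

(** The two expectations differ by at most |t| E|Q_h - Q_{s_k}| <= |t| / (k + 1). Taken for [cos]
    and [sin], it carries the characteristic function from test functions to all of H. *)
Let Rintegral_lipschitz_cvg (f : R -> R) (h : H) (s : nat -> schwartz R) (t : R) :
  measurable_fun setT f -> (forall x, `|f x| <= 1) -> (forall x y, `|f x - f y| <= `|x - y|) ->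
  (forall k, `|h - hc_embed H (s k)| <= k.+1%:R^-1) ->
  \int[P]_w f (t * Q (hc_embed H (s k)) w) @[k --> \oo] --> \int[P]_w f (t * Q h w).
Proof.
move=> mf f1 flip hs; have m := @measurableT _ (temperedM R).
have int_f h' : P.-integrable setT (EFin \o (fun w => f (t * Q h' w))).
  apply: (@le_integrable_EFin _ _ _ _ _ m _ (cst 1)) => //.
    by apply: measurableT_comp => //; exact: measurable_funM.
  exact: finite_measure_integrable_cst.
apply/cvgrPdist_le => e e0; near=> k.
rewrite -(RintegralB m (int_f _) (int_f _)).
rewrite (le_trans (le_normr_Rintegral m (integrableB_EFin m (int_f _) (int_f _))))//.
have D2 := Lfun2_sub (Q2 h) (Q2 (hc_embed H (s k))).
have iD : P.-integrable setT (EFin \o (fun w => Q h w - Q (hc_embed H (s k)) w)).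
  by apply/Lfun1_integrable; apply: Lfun_subset12 => //; exact: fin_num_measure.
have iabs := integrable_norm iD.
apply: (@le_trans _ _ (\int[P]_w (`|t| * `|Q h w - Q (hc_embed H (s k)) w|))).
  apply: le_Rintegral => //.
  - by apply: integrable_norm; exact: (integrableB_EFin m (int_f _) (int_f _)).
  - exact: integrableZl_EFin.
  - by move=> w _ /=; rewrite (le_trans (flip _ _))// -mulrBr normrM.
rewrite RintegralZl//.
apply: (@le_trans _ _ (`|t| * k.+1%:R^-1)).
  rewrite ler_wpM2l//; apply: Rintegral_abs_le => //.
  by rewrite white_noise_isometry_dist lerXn2r ?nnegrE// invr_ge0.
near: k.
have c : `|t| * @harmonic R k @[k --> \oo] --> `|t| * 0 by apply: cvgMr; exact: cvg_harmonic.
rewrite mulr0 in c; move/cvgrPdist_le : c => /(_ e e0).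
by apply: filterS => k; rewrite sub0r normrN ger0_norm// mulr_ge0// invr_ge0.
Unshelve. all: by end_near. Qed.

Let cos_lipschitz (x y : R) : `|cos x - cos y| <= `|x - y|.
Proof.
wlog xy : x y / x <= y.
  by move=> hw; have [/hw//|/ltW/hw] := leP x y; rewrite distrC (distrC x).
have cf : {within `[x, y], continuous (@cos R)}.
  by apply: continuous_subspaceT; exact: continuous_cos.
have [c _ e] := MVT_segment xy (fun z _ => is_derive_cos z) cf.
rewrite distrC (distrC x) e normrM normrN ler_piMl//.
by rewrite ler_norml sin_geN1 sin_le1.
Qed.

Let sin_lipschitz (x y : R) : `|sin x - sin y| <= `|x - y|.
Proof.
wlog xy : x y / x <= y.
  by move=> hw; have [/hw//|/ltW/hw] := leP x y; rewrite distrC (distrC x).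
have cf : {within `[x, y], continuous (@sin R)}.
  by apply: continuous_subspaceT; exact: continuous_sin.
have [c _ e] := MVT_segment xy (fun z _ => is_derive_sin z) cf.
rewrite distrC (distrC x) e normrM ler_piMl//.
by rewrite ler_norml cos_geN1 cos_le1.
Qed.

Lemma white_noise_char h (t : R) :
  \int[P]_w cos (t * Q h w) = expR (- (`|h| ^+ 2 * t ^+ 2 / 2)) /\
  \int[P]_w sin (t * Q h w) = 0.
Proof.
have [s hs] := embed_approx h.
have cs : `|hc_embed H (s k)| @[k --> \oo] --> `|h|.
  apply: cvg_norm; apply/cvgrPdist_le => e e0.
  have /cvgrPdist_le/(_ e e0) := @cvg_harmonic R.
  apply: filterS => k; rewrite sub0r normrN ger0_norm ?invr_ge0//.
  by apply: le_trans; exact: hs.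
have mcos : measurable_fun setT (@cos R) by apply: continuous_measurable_fun; exact: continuous_cos.
have msin : measurable_fun setT (@sin R) by apply: continuous_measurable_fun; exact: continuous_sin.
split.
  have c1' : forall x : R, `|cos x| <= 1 by move=> x; rewrite ler_norml cos_geN1 cos_le1.
  have := @Rintegral_lipschitz_cvg (@cos R) h s t mcos c1' cos_lipschitz hs.
  under eq_fun do rewrite (char_embed _ _).1.
  move=> c1; apply: (cvg_unique _ c1) => //.
  have c2 : - (`|hc_embed H (s k)| ^+ 2 * t ^+ 2 / 2) @[k --> \oo] -->
      - (`|h| ^+ 2 * t ^+ 2 / 2).
    apply: cvgN; apply: cvgMl; apply: cvgMl.
    exact: (cvg_comp _ _ cs (@exprn_continuous R 2 _)).
  exact: (cvg_comp _ _ c2 (@continuous_expR R _)).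
have s1 : forall x : R, `|sin x| <= 1 by move=> x; rewrite ler_norml sin_geN1 sin_le1.
have := @Rintegral_lipschitz_cvg (@sin R) h s t msin s1 sin_lipschitz hs.
under eq_fun do rewrite (char_embed _ _).2.
by move=> c1; apply: (cvg_unique _ c1) => //; exact: cvg_cst.
Qed.

(** Stated for X rather than [Q h], since linear combinations of the process agree with a value of Q
    only almost everywhere. *)
Lemma white_noise_gaussian_rv h X : X \in L2 -> {ae P, forall w, X w = Q h w} ->
  gaussian_rv P X.
Proof.
move=> X2 XQ; have mX := Lfun2_measurable X2.
apply: (@gaussian_rv_char _ _ _ P X `|h|) => //.
- rewrite -Qsqr; apply: Rintegral_ae_eq; [exact: measurable_funM..|].
  by apply: filterS XQ => w ->.
- move=> t; rewrite -(white_noise_char h t).1.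
  apply: Rintegral_ae_eq; [exact: measurable_cos_mul..|].
  by apply: filterS XQ => w ->.
- move=> t; rewrite -(white_noise_char h t).2.
  apply: Rintegral_ae_eq; [exact: measurable_sin_mul..|].
  by apply: filterS XQ => w ->.
Qed.

End white_noise_gaussian.

(** * Parseval for oriented integrals *)

Section oriented.
Context {R : realType}.
Local Notation mu := (@lebesgue_measure R).

Lemma oriented_integralB (f : R -> R) (a b : R) : continuous f -> a < b ->
  oriented_integral f 0 b - oriented_integral f 0 a = \int[mu]_(x in `[a, b]) f x.
Proof.
move=> cf ab.
have split (u v w : R) : u <= v -> v <= w ->
    \int[mu]_(x in `[u, w]) f x = \int[mu]_(x in `[u, v]) f x + \int[mu]_(x in `[v, w]) f x.
  move=> uv vw; have iw : mu.-integrable [set` Interval (BRight v) (BRight w)] (EFin \o f).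
    apply: (integrableS _ _ _ (integrable_itv_continuous u w cf)) => //.
    by apply: subset_itvr; rewrite bnd_simp.
  rewrite -(Rintegral_itv_obnd_cbnd iw).
  rewrite -(@Rintegral_itvB _ f (BLeft u) (BRight w) v) ?bnd_simp//; first by rewrite addrC subrK.
  exact: integrable_itv_continuous.
rewrite /oriented_integral; case: (leP 0 b) => b0; case: (leP 0 a) => a0.
- by rewrite (split 0 a b) ?(ltW ab)// addrC addKr.
- by rewrite opprK addrC -(split a 0 b)// ltW.
- by move: (lt_trans ab b0); rewrite ltNge a0.
- by rewrite opprK addrC (split a b 0) ?ltW// addrK.
Qed.

Lemma oriented_integral00 (f : R -> R) : oriented_integral f 0 0 = 0.
Proof. by rewrite /oriented_integral lexx set_itv1 Rintegral_set1. Qed.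

(** The form with two endpoints gives the squared distances between the vectors of the expansion;
    [l' = 0] gives their squared norms. *)
Lemma hermite_parseval (l l' : R) :
  \sum_(0 <= n < N) (oriented_integral (hermite_function n) 0 l -
     oriented_integral (hermite_function n) 0 l') ^+ 2 @[N --> \oo] --> `|l - l'|.
Proof.
wlog ll : l l' / l' <= l.
  move=> hw; have [/hw//|/ltW/hw] := leP l' l; rewrite distrC.
  by under eq_fun do under eq_bigr do rewrite -sqrrN opprB.
move: ll; rewrite le_eqVlt => /predU1P[->|ll].
  rewrite subrr normr0; apply: cvg_near_cst; apply: nearW => N.
  by rewrite big1// => n _; rewrite subrr expr0n.
rewrite ger0_norm ?subr_ge0 ?(ltW ll)//.
have cz n := @continuous_hermite_function R n.
by under eq_fun do under eq_bigr do rewrite (oriented_integralB (cz _) ll);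
  exact: hermite_parseval_itv.
Qed.

End oriented.

(** * Hermite expansion of one component *)

Section hermite_expansion.
Context {R : realType} (sigma : {measure set (measurableTypeR R) -> \bar R}).
Variable P : probability (temperedM R) R.
Hypothesis hP : is_white_noise_measure sigma P.
Variable H : white_noise_hilbert sigma.
Variable Q : H -> temperedM R -> R.
Hypothesis hQ : is_white_noise_isometry P Q.
Variable g : nat -> H.
Hypothesis hg : forall m n, hc_dot (g m) (g n) = (m == n)%:R.
Local Notation L2 := (Lfun P 2%:E).
Local Notation coef l n := (oriented_integral (hermite_function n) 0 l).

Let Q2 h : Q h \in L2. Proof. by have [] := hQ. Qed.

Let psum (l : R) N (w : temperedM R) : R := \sum_(n < N) coef l n * Q (g n) w.

(** The vector playing in H the part of the signed indicator of the interval between 0 and l, whose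
    Hermite coefficients are [coef l n]. *)
Let b (l : R) : H := limn (series (fun n => coef l n *: g n)).

Let psum2 l N : psum l N \in L2.
Proof. by apply: (@Lfun2_sum _ _ _ P (fun n => coef l n) (fun n => Q (g n))). Qed.

Let cvg_b (l : R) : series (fun n => coef l n *: g n) @ \oo --> b l.
Proof.
apply: cvg_sum_orthonormal => //.
have := @hermite_parseval R l 0; rewrite subr0 => h.
apply/cvg_ex; exists `|l|; move: h.
by under eq_fun do under eq_bigr do rewrite oriented_integral00 subr0.
Qed.

Let psumE (l : R) N : {ae P, forall w,
  Q (series (fun n => coef l n *: g n) N) w = psum l N w}.
Proof. by rewrite /series/= big_mkord; exact: (white_noise_isometry_sum hQ (fun n => coef l n) g N). Qed.

Let cvg_psum (l : R) :
  \int[P]_w ((psum l N w - Q (b l) w) * (psum l N w - Q (b l) w)) @[N --> \oo] --> 0.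
Proof.
have E N : \int[P]_w ((psum l N w - Q (b l) w) * (psum l N w - Q (b l) w)) =
    `|series (fun n => coef l n *: g n) N - b l| ^+ 2.
  have m h := Lfun2_measurable (Q2 h); have mp := Lfun2_measurable (psum2 l N).
  rewrite -(white_noise_isometry_dist hQ); apply: Rintegral_ae_eq.
  - by apply: measurable_funM; exact: measurable_funB.
  - by apply: measurable_funM; exact: measurable_funB.
  - by apply: filterS (psumE l N) => w ->.
under eq_fun do rewrite E.
have c0 : `|series (fun n => coef l n *: g n) N - b l| @[N --> \oo] --> `|b l - b l|.
  by apply: cvg_norm; apply: cvgB; [exact: cvg_b|exact: cvg_cst].
rewrite subrr normr0 in c0.
have := cvg_comp _ _ c0 (@exprn_continuous R 2 _).
by rewrite expr0n.
Qed.

Lemma hermite_expansion_exists (l : R) : exists2 Y, Y \in L2 &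
  ('N[P]_2%:E[EFin \o (fun w => \sum_(n < N) coef l n * Q (g n) w - Y w)%R])%E
    @[N --> \oo] --> 0%E.
Proof.
exists (Q (b l)) => //.
by apply/(Lnorm2_cvg0P (psum2 l) (Q2 (b l))); exact: cvg_psum.
Qed.

(** The Brownian increment variance. With b(0) = 0, polarization turns it into the covariance. *)
Let norm_b (u v : R) : `|b u - b v| ^+ 2 = `|u - v|.
Proof.
have c1 := @hermite_parseval R u v.
have c2 : `|series (fun n => coef u n *: g n) N - series (fun n => coef v n *: g n) N| ^+ 2
    @[N --> \oo] --> `|b u - b v| ^+ 2.
  have c3 : `|series (fun n => coef u n *: g n) N - series (fun n => coef v n *: g n) N|
      @[N --> \oo] --> `|b u - b v|.
    by apply: cvg_norm; apply: cvgB; exact: cvg_b.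
  exact: (cvg_comp _ _ c3 (@exprn_continuous R 2 _)).
apply: (cvg_unique _ c2) => //.
suff -> : (fun N => `|series (fun n => coef u n *: g n) N - series (fun n => coef v n *: g n) N| ^+ 2)
  = (fun N => \sum_(0 <= n < N) (coef u n - coef v n) ^+ 2) by exact: c1.
apply/funext => N; rewrite -(norm_sum_orthonormal hg).
congr (`|_| ^+ 2); rewrite /series/= -sumrB.
by apply: eq_bigr => n _; rewrite scalerBl.
Qed.

Let b0 : b 0 = 0.
Proof.
have c0 : series (fun n => coef 0 n *: g n) @ \oo --> (0 : H).
  apply: cvg_near_cst; apply: nearW => N; rewrite /series/= big1// => n _.
  by rewrite oriented_integral00 scale0r.
by apply: cvg_lim c0.
Qed.

Let dot_b (u v : R) : hc_dot (b u) (b v) = (`|u| + `|v| - `|u - v|) / 2.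
Proof.
have nb l : `|b l| ^+ 2 = `|l|.
  by have := norm_b l 0; rewrite b0 (subr0 (b l)) (subr0 l).
by rewrite (hc_dotE (b u) (b v)) (norm_b u v) (nb u) (nb v).
Qed.

Variables (I : Type) (l : I -> R) (B : I -> temperedM R -> R).
Hypothesis B2 : forall i, B i \in L2.
Hypothesis B_cvg : forall i,
  ('N[P]_2%:E[EFin \o (fun w => \sum_(n < N) coef (l i) n * Q (g n) w - B i w)%R])%E
    @[N --> \oo] --> 0%E.

(** Both sides are L^2 limits of the same partial sums. *)
Let BE i : {ae P, forall w, B i w = Q (b (l i)) w}.
Proof.
apply: (L2_limit_unique (psum2 (l i)) (B2 i) (Q2 _) _ (cvg_psum _)).
by apply/(Lnorm2_cvg0P (psum2 (l i)) (B2 i)); exact: B_cvg.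
Qed.

(** A combination of the B_i is almost surely Q of the same combination of vectors b. The parameter
    map [l] is abstract so that [hplus] and [hminus] can each take its place. *)
Lemma hermite_expansion_gaussian : gaussian_process P B.
Proof.
move=> n t a.
have aeQ : {ae P, forall w, \sum_(i < n) a i * B (t i) w =
    Q (\sum_(i < n) a i *: b (l (t i))) w}.
  elim: n t a => [|n ih] t a.
    have := white_noise_isometry_sum hQ (fun=> 0) (fun=> 0) 0.
    by apply: filterS => w; rewrite !big_ord0.
  have h1 := ih (fun i => t (lift ord0 i)) (fun i => a (lift ord0 i)).
  have h2 := BE (t ord0).
  have h3 := white_noise_isometry_lin hQ (a ord0) (b (l (t ord0)))
    (\sum_(i < n) a (lift ord0 i) *: b (l (t (lift ord0 i)))).
  apply: filterS3 h1 h2 h3 => w h1 h2.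
  by rewrite !big_ord_recl h1 h2 => ->.
apply: (white_noise_gaussian_rv hP hQ _ aeQ).
elim: n t a {aeQ} => [|n ih] t a.
  rewrite (_ : (fun w => _) = cst 0); last by apply/funext => w; rewrite big_ord0.
  exact: Lfun_cst.
rewrite (_ : (fun w => _) = (fun w => a ord0 * B (t ord0) w +
  \sum_(i < n) a (lift ord0 i) * B (t (lift ord0 i)) w)).
  exact: Lfun2_lin.
by apply/funext => w; rewrite big_ord_recl.
Qed.

Lemma hermite_expansion_covariance i j :
  \int[P]_w (B i w * B j w) = (`|l i| + `|l j| - `|l i - l j|) / 2.
Proof.
rewrite -dot_b -(white_noise_isometry_dot hQ); apply: Rintegral_ae_eq.
- by apply: measurable_funM; apply: Lfun2_measurable; exact: B2.
- by apply: measurable_funM; apply: Lfun2_measurable; exact: Q2.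
- by apply: filterS2 (BE i) (BE j) => w -> ->.
Qed.

End hermite_expansion.

(** * Idempotent coordinates *)

Section hyperbolic_components.
Context {R : realType}.
Implicit Types p q : hyperbolic R.

Lemma hplusD p q : hplus (p + q) = hplus p + hplus q.
Proof. by rewrite /hplus /=; ring. Qed.

Lemma hminusD p q : hminus (p + q) = hminus p + hminus q.
Proof. by rewrite /hminus /=; ring. Qed.

Lemma hplusN p : hplus (- p) = - hplus p.
Proof. by rewrite /hplus /=; ring. Qed.

Lemma hminusN p : hminus (- p) = - hminus p.
Proof. by rewrite /hminus /=; ring. Qed.

Lemma hplusM p q : hplus (p * q) = hplus p * hplus q.
Proof. by rewrite /hplus /=; ring. Qed.

Lemma hminusM p q : hminus (p * q) = hminus p * hminus q.
Proof. by rewrite /hminus /=; ring. Qed.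

Lemma hplus_partial_sum d (T : measurableType d) (Z W : nat -> T -> R) p N w :
  hplus (hermite_partial_sum Z W p N w) =
  \sum_(n < N) oriented_integral (hermite_function n) 0 (hplus p) * Z n w.
Proof.
rewrite /hermite_partial_sum (big_morph hplus hplusD (id1 := 0)).
  by apply: eq_bigr => n _; rewrite hplusE.
by rewrite /hplus /= addr0.
Qed.

Lemma hminus_partial_sum d (T : measurableType d) (Z W : nat -> T -> R) p N w :
  hminus (hermite_partial_sum Z W p N w) =
  \sum_(n < N) oriented_integral (hermite_function n) 0 (hminus p) * W n w.
Proof.
rewrite /hermite_partial_sum (big_morph hminus hminusD (id1 := 0)).
  by apply: eq_bigr => n _; rewrite hminusE.
by rewrite /hminus /= subr0.
Qed.

End hyperbolic_components.

Theorem theorem6p3 (R : realType)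
  (sigma mu : {measure set (measurableTypeR R) -> \bar R})
  (hsigma : growth_condition sigma) (hmu : growth_condition mu)
  (P1 P2 : probability (temperedM R) R)
  (hP1 : is_white_noise_measure sigma P1)
  (hP2 : is_white_noise_measure mu P2)
  (Hs : white_noise_hilbert sigma) (Hm : white_noise_hilbert mu)
  (sepHs : separable_space Hs) (sepHm : separable_space Hm)
  (infHs : infinite_dimensional Hs) (infHm : infinite_dimensional Hm)
  (Qs : Hs -> temperedM R -> R) (Qm : Hm -> temperedM R -> R)
  (hQs : is_white_noise_isometry P1 Qs)
  (hQm : is_white_noise_isometry P2 Qm)
  (g : nat -> Hs) (h : nat -> Hm)
  (hg : orthonormal_basis g) (hh : orthonormal_basis h) :
  let Z n := Qs (g n) in
  let W n := Qm (h n) in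
  let is_B (p : hyperbolic R) (X : temperedM R -> hyperbolic R) :=
    hL2 P1 P2 X /\ hL2_cvg P1 P2 (hermite_partial_sum Z W p) X in
  (forall p, exists X, is_B p X) /\
  (forall B : hyperbolic R -> temperedM R -> hyperbolic R,
    (forall p, is_B p (B p)) ->
    hgaussian_process P1 P2 B /\
    (forall p q, hcovariance P1 P2 B p q =
                 (1 / 2 : R) *: (habs p + habs q - habs (p - q)))).
Proof.
move=> Z W is_B; have [hg1 _] := hg; have [hh1 _] := hh.
split=> [p|B hB].
  have [Y1 Y12 c1] := hermite_expansion_exists hQs hg1 (hplus p).
  have [Y2 Y22 c2] := hermite_expansion_exists hQm hh1 (hminus p).
  exists (fun w => Y1 w *: eplus + Y2 w *: eminus); split; split.
  - by rewrite (_ : _ \o _ = Y1)//; apply/funext => w /=; rewrite hplusE.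
  - by rewrite (_ : _ \o _ = Y2)//; apply/funext => w /=; rewrite hminusE.
  - rewrite (_ : (fun N => _) = (fun N => 'N[P1]_2%:E[EFin \o (fun w =>
      \sum_(n < N) oriented_integral (hermite_function n) 0 (hplus p) * Qs (g n) w - Y1 w)%R])%E)//.
    apply/funext => N; congr (Lnorm _ _ (_ \o _)); apply/funext => w.
    by rewrite hplus_partial_sum hplusE.
  - rewrite (_ : (fun N => _) = (fun N => 'N[P2]_2%:E[EFin \o (fun w =>
      \sum_(n < N) oriented_integral (hermite_function n) 0 (hminus p) * Qm (h n) w - Y2 w)%R])%E)//.
    apply/funext => N; congr (Lnorm _ _ (_ \o _)); apply/funext => w.
    by rewrite hminus_partial_sum hminusE.
have B1 p : (fun w => hplus (B p w)) \in Lfun P1 2%:E by have [[]] := hB p.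
have B2 p : (fun w => hminus (B p w)) \in Lfun P2 2%:E by have [[]] := hB p.
have c1 p : (('N[P1]_2%:E[EFin \o (fun w => \sum_(n < N)
    oriented_integral (hermite_function n) 0 (hplus p) * Qs (g n) w - hplus (B p w))%R])%E
    @[N --> \oo] --> 0%E).
  have [_ [hc _]] := hB p.
  rewrite (_ : (fun N => _) = (fun N => 'N[P1]_2%:E[EFin \o (fun w =>
    hplus (hermite_partial_sum Z W p N w) - hplus (B p w))%R])%E)//.
  apply/funext => N; congr (Lnorm _ _ (_ \o _)); apply/funext => w.
  by rewrite hplus_partial_sum.
have c2 p : (('N[P2]_2%:E[EFin \o (fun w => \sum_(n < N)
    oriented_integral (hermite_function n) 0 (hminus p) * Qm (h n) w - hminus (B p w))%R])%E
    @[N --> \oo] --> 0%E).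
  have [_ [_ hc]] := hB p.
  rewrite (_ : (fun N => _) = (fun N => 'N[P2]_2%:E[EFin \o (fun w =>
    hminus (hermite_partial_sum Z W p N w) - hminus (B p w))%R])%E)//.
  apply/funext => N; congr (Lnorm _ _ (_ \o _)); apply/funext => w.
  by rewrite hminus_partial_sum.
split.
  split; first by move=> p; have [] := hB p.
  - exact: (hermite_expansion_gaussian hP1 hQs hg1 B1 c1).
  - exact: (hermite_expansion_gaussian hP2 hQm hh1 B2 c2).
move=> p q; rewrite /hcovariance /hexpectation.
(* The idempotent coordinates are multiplicative, so each component of the covariance is a real
   covariance under a single measure. *)
have -> : fine ('E_P1[hplus \o (fun w => B p w * B q w)%R])%E =
    (`|hplus p| + `|hplus q| - `|hplus p - hplus q|) / 2.
  rewrite -(hermite_expansion_covariance hQs hg1 B1 c1) unlock.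
  by apply: eq_Rintegral => w _ /=; rewrite hplusM.
have -> : fine ('E_P2[hminus \o (fun w => B p w * B q w)%R])%E =
    (`|hminus p| + `|hminus q| - `|hminus p - hminus q|) / 2.
  rewrite -(hermite_expansion_covariance hQm hh1 B2 c2) unlock.
  by apply: eq_Rintegral => w _ /=; rewrite hminusM.
rewrite /habs hplusD hminusD hplusN hminusN.
by apply: hypP => /=; field.
Qed.
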